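(* Let $n>1$. Game II.2 (the no-information, zero-sum Showcase Showdown game with unlimited spins) with $n$ players admits a Nash equilibrium in which all players use the same threshold $\gamma_n$. Moreover, in this equilibrium, the tying probability (the probability that all scores are $0$) is $$\widehat{P}_n=\left(1-e^{\gamma_n}+e^{\gamma_n}\gamma_n\right)^n,$$ the winning probability of each player is $$P_n=\frac{1-\left(1-e^{\gamma_n}+e^{\gamma_n}\gamma_n\right)^n}{n},$$ and the expected payoff of each player is $0$.
   Context: Score of a player using a greed threshold: let $Z_1,Z_2,\dots$ be independent random variables uniformly distributed on $[0,1]$ and $\chi_k=Z_1+\dots+Z_k$. For $\tau\in[0,1]$ let $N=\min\{k\ge1:\chi_k\ge\tau\}$. The score $\xi_\tau$ is $\chi_N$ if $\chi_N\le1$ and $0$ if $\chi_N>1$. Game II.2: there are $n$ players. Player $i$ chooses a threshold $\kappa_i\in[0,1]$ with no information about the other players, and obtains the score $\xi^{(i)}_{\kappa_i}$, where the scores of different players are independent and $\xi^{(i)}_{\kappa_i}$ is distributed as $\xi_{\kappa_i}$. The winner is the player with the greatest score; if all scores are $0$ there is a tie (no winner). If there is a winner, each of the other $n-1$ players pays him $1/(n-1)$, so the winner's payoff is $1$ and every other player's payoff is $-1/(n-1)$. If all scores are $0$, every payoff is $0$. A Nash equilibrium is a profile $(\kappa_1,\dots,\kappa_n)$ such that no player can increase his expected payoff by unilaterally changing his own threshold. For $n>1$, $\gamma_n$ denotes the unique solution $x\in(0,1)$ of $$\left(1+e^{x}(x-1)\right)^{n-1}=\frac{1}{1+e^{x}(n-1)}.$$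 *)

(* Defs.v *)
From HB Require Import structures.
From mathcomp Require Import all_boot all_order all_algebra.
From mathcomp Require Import all_classical all_reals all_analysis.

Set Implicit Arguments.
Unset Strict Implicit.
Unset Printing Implicit Defensive.
Import Order.TTheory GRing.Theory Num.Theory.
Import numFieldNormedType.Exports.
Local Open Scope classical_set_scope.
Local Open Scope ring_scope.

Definition mutually_independent (R : realType) (d : measure_display)
    (T : measurableType d) (P : probability T R) (I : eqType)
    (X : I -> {RV P >-> R}) : Prop :=
  forall (J : seq I) (B : I -> set R), uniq J ->
    (forall i, measurable (B i)) ->
    P (\bigcap_(i in [set` J]) (X i @^-1` B i)) =
    (\prod_(i <- J) P (X i @^-1` B i))%E.

Definition uniform01 (R : realType) (d : measure_display)
    (T : measurableType d) (P : probability T R) (X : {RV P >-> R}) : Prop :=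
  forall B : set R, measurable B ->
    distribution P X B = uniform_prob (@ltr01 R) B.

(* The k-th spin is z k.-1 (spins are counted from 1, sequences from 0). *)
Definition chi (R : realType) (z : nat -> R) (k : nat) : R :=
  \sum_(j < k) z j.

Definition reached (R : realType) (tau : R) (z : nat -> R) : pred nat :=
  fun k => (0 < k)%N && (tau <= chi z k).

(* On the sequences of spins whose sums never reach tau, a null event where
   the stopping time is undefined, the score is 0. *)
Definition score (R : realType) (tau : R) (z : nat -> R) : R :=
  match pselect (exists k, reached tau z k) with
  | left reach =>
      let N := ex_minn reach in
      if chi z N <= 1 then chi z N else 0
  | right _ => 0
  end.

(* A positive greatest score attained by several players, again a null event,
   has no winner. *)
Definition wins (R : realType) (n : nat) (s : 'I_n -> R) (i : 'I_n) : bool :=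
  (0 < s i) && [forall j : 'I_n, (j != i) ==> (s j < s i)].

Definition payoff (R : realType) (n : nat) (s : 'I_n -> R) (i : 'I_n) : R :=
  if wins s i then 1
  else if [exists j, wins s j] then - (n%:R - 1)^-1
  else 0.

Definition admissible (R : realType) (n : nat) (kappa : 'I_n -> R) : Prop :=
  forall i, 0 <= kappa i <= 1.

(* xi i t is the score of player i using the threshold t.  No joint law is
   imposed on the scores of one player for different thresholds. *)
Definition game_scores (R : realType)
    (d0 : measure_display) (T0 : measurableType d0) (P0 : probability T0 R)
    (Z : nat -> {RV P0 >-> R})
    (d : measure_display) (T : measurableType d) (P : probability T R)
    (n : nat) (xi : 'I_n -> R -> {RV P >-> R}) : Prop :=
  (forall (i : 'I_n) (t : R), 0 <= t <= 1 ->
     forall B : set R, measurable B ->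
       distribution P (xi i t) B =
       P0 [set w | B (score t (fun k => Z k w))]) /\
  (forall kappa : 'I_n -> R, admissible kappa ->
     mutually_independent (fun i => xi i (kappa i))).

Definition expected_payoff (R : realType) (d : measure_display)
    (T : measurableType d) (P : probability T R) (n : nat)
    (xi : 'I_n -> R -> {RV P >-> R}) (kappa : 'I_n -> R) (i : 'I_n) : \bar R :=
  ('E_P[fun w => payoff (fun j => xi j (kappa j) w) i])%E.

Definition deviate (R : realType) (n : nat) (kappa : 'I_n -> R)
    (i : 'I_n) (t : R) : 'I_n -> R :=
  fun j => if j == i then t else kappa j.

Definition nash_equilibrium (R : realType) (d : measure_display)
    (T : measurableType d) (P : probability T R) (n : nat)
    (xi : 'I_n -> R -> {RV P >-> R}) (kappa : 'I_n -> R) : Prop :=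
  admissible kappa /\
  forall (i : 'I_n) (t : R), 0 <= t <= 1 ->
    (expected_payoff xi (deviate kappa i t) i <= expected_payoff xi kappa i)%E.

Definition gamma_spec (R : realType) (n : nat) (x : R) : Prop :=
  0 < x < 1 /\
  (1 + expR x * (x - 1)) ^+ (n - 1) = 1 / (1 + expR x * (n%:R - 1)).

(* The default value 0 of xget is irrelevant for n > 1, where gamma_spec n has
   exactly one solution. *)
Definition gamma (R : realType) (n : nat) : R :=
  xget 0 [set x : R | gamma_spec n x].

(* Main.v *)
Require Import Defs.
From mathcomp Require Import all_boot all_order all_algebra.
From mathcomp Require Import all_classical all_reals all_analysis.
From mathcomp Require Import measurable_realfun ring lra.
Import Order.TTheory GRing.Theory Num.Theory.
Import numFieldNormedType.Exports.
Local Open Scope classical_set_scope.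
Local Open Scope ring_scope.

(* Let chi_k be the partial sums of the spins.  Given chi_k < tau <= x <= 1, the
   next spin brings the sum into [x, 1] with probability 1 - x, and
   P(chi_k < tau) = tau^k / k!; summing over k, P(score >= x) = e^tau (1 - x).
   Only the independence of rectangles is used: every integral against the law
   of a partial sum or of a score is squeezed between Riemann sums over a grid
   of m cells, with an error O(1/m).

   Put g = gamma_n, p = P(score_g = 0) = 1 - e^g (1 - g), a = p^(n-1).  If one
   player uses t and the others g, his winning probability W is at most
   e^t (c - t) u^(n-1) + e^(t-g) (1 - u^n) / n, where c = max(t, g) and
   u = P(score_g < c).  As u^n >= p^n + n a (u - p), this gives
   n W + P(all scores are 0) <= a (1 + (n - 1) e^t (1 + g - t))
                             <= a (1 + (n - 1) e^g) = 1,
   which says that his payoff is at most 0.  If all players use g, the bound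
   reads W <= (1 - p^n) / n; since ties at a positive score are null, the n
   winning probabilities sum to 1 - p^n, so each bound is an equality. *)

(** * The equation defining gamma *)

Section Gamma.
Set Implicit Arguments.
Unset Strict Implicit.
Variable R : realType.
Implicit Types (n : nat) (x y t : R).

(** The probability that a player with threshold [t] scores 0; [game_scores_law] establishes
    this. *)
Definition bust t : R := 1 - expR t * (1 - t).

Lemma bustE t : bust t = 1 + expR t * (t - 1).
Proof. by rewrite /bust; ring. Qed.

Lemma expR_mul1B_lt1 x : 0 < x -> expR x * (1 - x) < 1.
Proof.
move=> x0; rewrite -[ltRHS](expRxMexpNx_1 x) ltr_pM2l ?expR_gt0//.
by apply: expR_gt1Dx; rewrite oppr_eq0 gt_eqF.
Qed.

(** With [h = y - x], the factor [expR x] cancels and [expR h * (1 - x - h) < 1 - x] is left. It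
    holds because [1 - x - h <= (1 - h) * (1 - x)] and [expR h * (1 - h) < 1]; no derivative is
    taken. *)
Lemma bust_lt x y : 0 <= x -> x < y -> y <= 1 -> bust x < bust y.
Proof.
move=> x0 xy y1; rewrite /bust ltrD2l ltrN2.
rewrite -[y](subrKC x) [in ltLHS]expRD -mulrA ltr_pM2l ?expR_gt0//.
set h := y - x; have h0 : 0 < h by rewrite subr_gt0.
have h1 : expR h * (1 - (x + h)) <= expR h * (1 - h) * (1 - x).
  rewrite -mulrA ler_pM2l ?expR_gt0//.
  have := mulr_ge0 x0 (ltW h0); lra.
apply: (le_lt_trans h1); rewrite gtr_pMl ?expR_mul1B_lt1//.
by rewrite subr_gt0 (lt_le_trans xy).
Qed.

Lemma bust0 : bust 0 = 0 :> R.
Proof. by rewrite /bust expR0; ring. Qed.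

Lemma bust1 : bust 1 = 1 :> R.
Proof. by rewrite /bust; ring. Qed.

Lemma bust_ge0 x : 0 <= x <= 1 -> 0 <= bust x.
Proof.
case/andP; rewrite le_eqVlt => /predU1P[<-|x0] x1; first by rewrite bust0.
by rewrite -bust0 ltW// bust_lt.
Qed.

(** Cleared of its denominator, the equation reads [f x = 1] with [f] continuous and strictly
    increasing on [[0, 1]], [f 0 = 0] and [f 1 > 1]. The intermediate value theorem gives a root and
    monotonicity its uniqueness. *)
Lemma gamma_spec_unique n : (1 < n)%N -> unique (@gamma_spec R n) (gamma R n).
Proof.
move=> n1; have n0 : 1 < n%:R :> R by rewrite ltr1n.
have nm0 : (0 < n - 1)%N by rewrite subn_gt0.
pose f x : R := bust x ^+ (n - 1) * (1 + expR x * (n%:R - 1)).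
have c0 x : 0 < 1 + expR x * (n%:R - 1).
  by rewrite addr_gt0// mulr_gt0 ?expR_gt0 ?subr_gt0.
have specE x : gamma_spec n x <-> 0 < x < 1 /\ f x = 1.
  rewrite /gamma_spec -bustE /f; split=> -[x01 h]; split=> //.
    by rewrite h div1r mulVf// gt_eqF.
  by apply: (mulIf (lt0r_neq0 (c0 x))); rewrite h div1r mulVf// gt_eqF.
have fmono x y : 0 <= x -> x < y -> y <= 1 -> f x < f y.
  move=> x0 xy y1; rewrite /f ltr_pM//.
  - by rewrite exprn_ge0// bust_ge0// x0 (le_trans (ltW xy)).
  - exact: ltW.
  - rewrite ltrXn2r -?lt0n ?bust_lt//;
    last by rewrite bust_ge0// x0 (le_trans (ltW xy)).
  - by rewrite ltrD2l ltr_pM2r ?subr_gt0// ltr_expR.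
have fc : continuous f.
  move=> x; apply: cvgM; last first.
    by apply: cvgD; [exact: cvg_cst|apply: cvgMl; exact: continuous_expR].
  apply: (@continuous_comp _ _ _ bust (fun z : R => z ^+ (n - 1))); last first.
    exact: exprn_continuous.
  rewrite /bust; apply: cvgB; first exact: cvg_cst.
  apply: cvgM; first exact: continuous_expR.
  by apply: cvgB; [exact: cvg_cst|exact: cvg_id].
have f0 : f 0 = 0 by rewrite /f bust0 expr0n -leqn0 leqNgt nm0/= mul0r.
have f1 : 1 < f 1.
  by rewrite /f bust1 expr1n mul1r ltrDl mulr_gt0 ?expR_gt0 ?subr_gt0.
have [c] : exists2 c, c \in `[0, 1] & f c = 1.
  apply: IVT => //; first exact: continuous_subspaceT.
  by rewrite f0 ge_min le_max ler01 (ltW f1) orbT.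
rewrite in_itv/= => /andP[c0' c1] fc1.
have {c0' c1} c01 : 0 < c < 1.
  rewrite !lt_neqAle c0' c1 !andbT; apply/andP; split; apply/eqP => cE.
    by move: fc1; rewrite -cE f0 => /eqP; rewrite eq_sym oner_eq0.
  by move: f1; rewrite -[X in f X]cE fc1 ltxx.
have cuniq x : gamma_spec n x -> x = c.
  move=> /specE[/andP[x0 x1] fx1]; case/andP: c01 => cgt0 clt1.
  have [xc|xc|//] := ltgtP x c.
    by have := fmono _ _ (ltW x0) xc (ltW clt1); rewrite fx1 fc1 ltxx.
  by have := fmono _ _ (ltW cgt0) xc (ltW x1); rewrite fx1 fc1 ltxx.
(* The default branch of [xget] would mean that no solution exists, which [c] refutes. *)
have gc : gamma R n = c.
  by rewrite /gamma; case: xgetP => [y _ /cuniq//|/(_ c)]; case; exact/specE.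
by rewrite gc; split; [exact/specE|move=> x /cuniq].
Qed.

(** [y ^+ n - x ^+ n] is [y - x] times a sum of [n] monomials of degree [n.-1], each at least
    [x ^+ n.-1]. In the next lemma each is at most [y ^+ n.-1]. These two bounds replace
    differentiation and integration of powers throughout. *)
Lemma expr_tangent_le n x y : 0 <= x <= y ->
  x ^+ n + n%:R * (x ^+ n.-1 * (y - x)) <= y ^+ n.
Proof.
case/andP=> x0 xy; rewrite -lerBrDl subrXX mulrA [leLHS]mulrC.
apply: ler_wpM2l; first by rewrite subr_ge0.
rewrite -[n in n%:R]card_ord mulr_natl -sumr_const; apply: ler_sum => i _.
have -> : x ^+ n.-1 = x ^+ (n.-1 - i) * x ^+ i.
  by rewrite -exprD subnK// -ltnS prednK// (leq_ltn_trans _ (ltn_ord i)).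
apply: ler_wpM2r; first exact: exprn_ge0.
by rewrite lerXn2r ?nnegrE// (le_trans x0).
Qed.

Lemma expr_tangent_ge n x y : 0 <= x <= y ->
  y ^+ n <= x ^+ n + n%:R * (y ^+ n.-1 * (y - x)).
Proof.
case/andP=> x0 xy; rewrite -lerBlDl subrXX mulrA [leRHS]mulrC.
apply: ler_wpM2l; first by rewrite subr_ge0.
rewrite -[n in n%:R]card_ord mulr_natl -sumr_const; apply: ler_sum => i _.
have -> : y ^+ n.-1 = y ^+ (n.-1 - i) * y ^+ i.
  by rewrite -exprD subnK// -ltnS prednK// (leq_ltn_trans _ (ltn_ord i)).
apply: ler_wpM2l; first by rewrite exprn_ge0// (le_trans x0).
by rewrite lerXn2r ?nnegrE// (le_trans x0).
Qed.

(* The left-hand side is [n W + P(all scores are 0)] for a player deviating to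
   [t], his winning probability [W] being replaced by the upper bound of
   [deviation_wins_le]; his payoff is this quantity minus 1, over [n - 1]. *)
Lemma deviation_gain_le1 n x t : (1 < n)%N -> gamma_spec n x -> 0 <= t <= 1 ->
  let c := Num.max t x in
  let u := 1 - expR x * (1 - c) in
  n%:R * (expR t * (c - t) * u ^+ n.-1 + expR (t - x) * ((1 - u ^+ n) / n%:R))
    + bust t * bust x ^+ n.-1 <= 1.
Proof.
move=> n1 [/andP[x0 x1]]; rewrite -bustE subn1 => gx /andP[t0 t1] /=.
set c := Num.max t x; set u := 1 - expR x * (1 - c).
set p := bust x in gx *; set a := p ^+ n.-1 in gx *.
have n0 : n%:R != 0 :> R by rewrite pnatr_eq0 -lt0n (ltn_trans _ n1).
have p0 : 0 <= p by rewrite bust_ge0 ?(ltW x0) ?ltW.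
have a0 : 0 <= a by rewrite exprn_ge0.
have upE : u - p = expR x * (c - x) by rewrite /u /p /bust; ring.
have pu : 0 <= p <= u.
  by rewrite p0 -subr_ge0 upE mulr_ge0 ?expR_ge0// subr_ge0 le_max lexx orbT.
(* Either [c = t] and both sides vanish, or [c = x] and then [u = p]. *)
have first : (c - t) * u ^+ n.-1 = (c - t) * a.
  rewrite /c /a; have [xt|tx] := leP x t; first by rewrite subrr !mul0r.
  by congr (_ * _ ^+ _); rewrite /u /c (max_idPr (ltW tx)).
have d0 : 0 < 1 + expR x * (n%:R - 1).
  by rewrite addr_gt0// mulr_gt0 ?expR_gt0// subr_gt0 ltr1n.
have a1 : a * (1 + expR x * (n%:R - 1)) = 1 by rewrite gx div1r mulVf// gt_eqF.
have pn : p ^+ n = a * p by rewrite /a -exprSr prednK// (ltn_trans _ n1).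
have tang := expr_tangent_le n pu.
have -> : n%:R * (expR t * (c - t) * u ^+ n.-1 +
     expR (t - x) * ((1 - u ^+ n) / n%:R)) =
   n%:R * (expR t * (c - t) * a) + expR (t - x) * (1 - u ^+ n).
  by rewrite -mulrA first; field.
(* The power [u ^+ n] is replaced by its tangent at [p], which is linear in [c]. *)
have step1 : expR (t - x) * (1 - u ^+ n) <=
    expR (t - x) * (1 - (a * p + n%:R * (a * (u - p)))).
  by rewrite ler_pM2l ?expR_gt0// lerD2l lerN2 -pn.
(* The equation of [gamma], in the form [a1], rewrites the constant 1 as a multiple of [a], so that
   [a] factors out. *)
have step2 : expR (t - x) * (1 - (a * p + n%:R * (a * (u - p)))) =
    expR t * a * (n%:R - x - n%:R * (c - x)).
  have -> : 1 - (a * p + n%:R * (a * (u - p))) =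
      expR x * (a * (n%:R - x - n%:R * (c - x))).
    by rewrite -[X in X - _]a1 upE /p /bust; ring.
  by rewrite mulrA -expRD subrK; ring.
(* The terms in [c] cancel. What remains is [1 + h <= expR h] at [h = x - t], with equality at
   [t = x]. *)
apply: (@le_trans _ _ (a * (1 + expR t * (1 + (x - t)) * (n%:R - 1)))).
  move: step1; rewrite step2 => step1.
  apply: (le_trans (lerD (lerD (lexx _) step1) (lexx _))).
  by rewrite le_eqVlt; apply/orP; left; apply/eqP; rewrite /bust; ring.
rewrite -[leRHS]a1; apply: ler_wpM2l => //;
  rewrite lerD2l ler_pM2r ?subr_gt0 ?ltr1n//.
have -> : expR x = expR t * expR (x - t) by rewrite -expRD subrKC.
by rewrite ler_pM2l ?expR_gt0// expR_ge1Dx.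
Qed.

End Gamma.

(** * Probabilities as real numbers *)

Section Probability.
Set Implicit Arguments.
Unset Strict Implicit.
Context {R : realType} {d : measure_display} {T : measurableType d}.
Variable P : probability T R.
Implicit Types (A B E : set T) (X : T -> R).

Definition pr A : R := fine (P A).

Lemma prE A : measurable A -> P A = (pr A)%:E.
Proof. by move=> mA; rewrite /pr fineK// fin_num_measure. Qed.

Lemma pr_ge0 A : 0 <= pr A.
Proof. by rewrite /pr fine_ge0. Qed.

Lemma pr_mono A B : measurable A -> measurable B -> A `<=` B -> pr A <= pr B.
Proof. by move=> mA mB AB; rewrite -lee_fin -!prE// le_measure ?inE. Qed.

Lemma pr_setT : pr setT = 1.
Proof. by rewrite /pr probability_setT. Qed.

Lemma pr_set0 : pr set0 = 0.
Proof. by rewrite /pr measure0. Qed.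

Lemma pr_le1 A : measurable A -> pr A <= 1.
Proof. by move=> mA; rewrite -pr_setT pr_mono. Qed.

Lemma prU A B : measurable A -> measurable B -> A `&` B = set0 ->
  pr (A `|` B) = pr A + pr B.
Proof.
move=> mA mB AB; have mAB : measurable (A `|` B) by exact: measurableU.
by apply: EFin_inj; rewrite -prE// measureU// EFinD -!prE.
Qed.

Lemma prC A : measurable A -> pr (~` A) = 1 - pr A.
Proof.
move=> mA; apply: EFin_inj; rewrite -prE; last exact: measurableC.
by rewrite probability_setC// prE.
Qed.

Lemma prDI A B : measurable A -> measurable B ->
  pr (A `\` B) = pr A - pr (A `&` B).
Proof.
move=> mA mB; rewrite -{2}(setDUK (@subIsetl _ A B)) setDIr setDv set0U.
rewrite prU; last 3 first.
- exact: measurableI.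
- exact: measurableD.
- by apply/seteqP; split=> // x [[_ Bx] [_]].
by ring.
Qed.

Lemma pr_leU A B E : measurable A -> measurable B -> measurable E ->
  E `<=` A `|` B -> pr E <= pr A + pr B.
Proof.
move=> mA mB mE EAB; apply: (@le_trans _ _ (pr (A `|` (B `\` A)))).
  by apply: pr_mono => //; [apply: measurableU => //;
    exact: measurableD|rewrite setUDr setDv setD0].
rewrite prU//; last 2 first.
- exact: measurableD.
- by apply/seteqP; split=> // x [Ax [_]].
by rewrite lerD2l pr_mono//; exact: measurableD.
Qed.

Lemma measurable_preim X (B : set R) : measurable_fun setT X -> measurable B ->
  measurable (X @^-1` B).
Proof. by move=> mX mB; rewrite -[_ @^-1` _]setTI; exact: mX. Qed.

Lemma measurable_lt X y : measurable_fun setT X ->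
  measurable [set w | X w < y].
Proof.
move=> mX; have := measurable_preim mX (measurable_itv `]-oo, y[).
by rewrite /preimage/=; under eq_set do rewrite in_itv/=.
Qed.

Lemma measurable_ge X y : measurable_fun setT X ->
  measurable [set w | y <= X w].
Proof.
move=> mX; have := measurable_preim mX (measurable_itv `[y, +oo[).
by rewrite /preimage/=; under eq_set do rewrite in_itv/= andbT.
Qed.

Lemma measurable_co X x y : measurable_fun setT X ->
  measurable [set w | x <= X w < y].
Proof.
move=> mX; have := measurable_preim mX (measurable_itv `[x, y[).
by rewrite /preimage/=; under eq_set do rewrite in_itv/=.
Qed.

Lemma measurable_cc X x y : measurable_fun setT X ->
  measurable [set w | x <= X w <= y].
Proof.
move=> mX; have := measurable_preim mX (measurable_itv `[x, y]).
by rewrite /preimage/=; under eq_set do rewrite in_itv/=.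
Qed.

(** Half-open cells are disjoint and fill the range from [s 0] to [s m] exactly. All later Riemann
    sums start from this splitting of an event according to the cell that contains [X]. *)
Lemma pr_grid X E (s : nat -> R) m : measurable_fun setT X -> measurable E ->
  {homo s : i j / (i <= j)%N >-> i <= j} ->
  pr (E `&` [set w | s 0%N <= X w < s m]) =
  \sum_(k < m) pr (E `&` [set w | s k <= X w < s k.+1]).
Proof.
move=> mX mE s_homo; elim: m => [|m IH].
  rewrite big_ord0 (_ : _ `&` _ = set0) ?pr_set0//.
  by apply/seteqP; split=> // w [_ /= /andP[/le_lt_trans h /h]]; rewrite ltxx.
have mI x y : measurable (E `&` [set w | x <= X w < y]).
  by apply: measurableI => //; exact: measurable_co.
rewrite big_ord_recr/= -IH -prU//.
  congr pr; rewrite -setIUr; congr (_ `&` _); apply/seteqP; split=> w /=.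
    by case/andP=> -> ->; have [] := ltP (X w) (s m); [left|right].
  case=> /andP[h1 h2]; apply/andP; split=> //.
    by rewrite (lt_le_trans h2)// s_homo.
  by rewrite (le_trans _ h1)// s_homo.
apply/seteqP; split=> // w [[_ /andP[_ h1]] [_ /andP[h2 _]]].
by have := lt_le_trans h1 h2; rewrite ltxx.
Qed.

Lemma pr_indep (I : eqType) (Y : I -> {RV P >-> R}) (J : seq I)
    (B : I -> set R) : mutually_independent Y -> uniq J ->
  (forall i, measurable (B i)) ->
  pr (\bigcap_(i in [set` J]) (Y i @^-1` B i)) =
  \prod_(i <- J) pr (Y i @^-1` B i).
Proof.
move=> Yindep uJ mB; rewrite {1}/pr Yindep//.
rewrite (eq_bigr (fun i => (pr (Y i @^-1` B i))%:E)) ?prodEFin// => i _.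
by rewrite prE//; exact: measurable_preim.
Qed.

End Probability.

(** * Passing to the limit in grid estimates *)

Lemma le_of_le_add_inv (R : realType) (C a b : R) :
  (forall m, (0 < m)%N -> a <= b + C / m%:R) -> a <= b.
Proof.
move=> h; apply/ler_addgt0Pl => e e0; rewrite addrC.
have C0 : 0 < `|C| + 1 by rewrite ltr_wpDl.
pose m := (Num.truncn ((`|C| + 1) / e)).+1.
apply: (le_trans (h m isT)); rewrite lerD2l ler_pdivrMr ?ltr0n//.
have : (`|C| + 1) / e < m%:R by rewrite truncnS_gt.
rewrite ltr_pdivrMr// mulrC => /ltW; apply: le_trans.
by rewrite (le_trans (ler_norm _))// lerDl.
Qed.

Lemma eq_of_dist_le_inv (R : realType) (C a b : R) :
  (forall m, (0 < m)%N -> b - C / m%:R <= a <= b + C / m%:R) -> a = b.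
Proof.
move=> h; apply/le_anti/andP; split; apply: (@le_of_le_add_inv _ C) => m m0.
  by case/andP: (h m m0).
by rewrite -lerBlDr; case/andP: (h m m0).
Qed.

Section Telescope.
Set Implicit Arguments.
Unset Strict Implicit.
Variables (R : realType) (m : nat) (a G : nat -> R).

(** [G] acts as an integral from the grid point [l] to the end, possibly with an error term added: a
    sum over the grid is then estimated one cell at a time. *)
Lemma sum_le_telescope : (forall l, (l < m)%N -> a l <= G l - G l.+1) ->
  \sum_(l < m) a l <= G 0%N - G m.
Proof.
elim: m => [_|n IH h]; first by rewrite big_ord0 subrr.
rewrite big_ord_recr/= -[leRHS](subrKA (G n)); apply: lerD; last exact: h.
by apply: IH => l ln; rewrite h// ltnW.
Qed.

Lemma sum_ge_telescope : (forall l, (l < m)%N -> G l - G l.+1 <= a l) ->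
  G 0%N - G m <= \sum_(l < m) a l.
Proof.
elim: m => [_|n IH h]; first by rewrite big_ord0 subrr.
rewrite big_ord_recr/= -[leLHS](subrKA (G n)); apply: lerD; last exact: h.
by apply: IH => l ln; rewrite h// ltnW.
Qed.

End Telescope.

(** * Partial sums of the spins *)

Section PowerBounds.
Set Implicit Arguments.
Unset Strict Implicit.
Variable R : realType.
Implicit Types (x y : R).

(** The volume of the simplex of nonnegative points of [R^k] with coordinate sum at most [x]; for
    [x <= 1] and [k > 0] it is the probability that [k] spins sum to less than [x]. *)
Definition pow_fact k x : R := x ^+ k / k`!%:R.

Lemma pow_fact_ge0 k x : 0 <= x -> 0 <= pow_fact k x.
Proof. by move=> x0; rewrite divr_ge0// exprn_ge0. Qed.

Lemma pow_fact_le1 k x : 0 <= x <= 1 -> pow_fact k x <= 1.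
Proof.
case/andP=> x0 x1; rewrite ler_pdivrMr ?ltr0n ?fact_gt0// mul1r.
rewrite (@le_trans _ _ 1) ?exprn_ile1//.
by rewrite ler1n fact_gt0.
Qed.

(** The derivative of [pow_fact k.+1] is [pow_fact k], which is nondecreasing: these are the lower
    and upper Riemann bounds of its integral over one cell. *)
Lemma pow_fact_step k x y : 0 <= x <= y ->
  (y - x) * pow_fact k x <= pow_fact k.+1 y - pow_fact k.+1 x /\
  pow_fact k.+1 y - pow_fact k.+1 x <= (y - x) * pow_fact k y.
Proof.
move=> xy; have k0 : k.+1%:R != 0 :> R by rewrite pnatr_eq0.
have kf : k`!%:R != 0 :> R by rewrite pnatr_eq0 -lt0n fact_gt0.
have fS z : (y - x) * pow_fact k z = (k.+1%:R * (z ^+ k * (y - x))) / k.+1`!%:R.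
  by rewrite /pow_fact factS natrM; field; rewrite kf nat1r.
have fp : 0 <= (k.+1`!%:R)^-1 :> R by rewrite invr_ge0.
rewrite !fS /pow_fact -mulrBl; split; apply: ler_wpM2r => //.
  by have := expr_tangent_le k.+1 xy; rewrite /= -lerBrDl.
by have := expr_tangent_ge k.+1 xy; rewrite /= -lerBlDl.
Qed.

End PowerBounds.

Section Spins.
Set Implicit Arguments.
Unset Strict Implicit.
Context {R : realType} {d : measure_display} {T : measurableType d}.
Variables (P : probability T R) (Z : nat -> {RV P >-> R}).
Hypothesis Zunif : forall k, uniform01 (Z k).
Hypothesis Zindep : mutually_independent Z.
Implicit Types (E : set T) (C : set R) (x y u v : R).

(** The density is 1 on the interval, so the integral is its length, whichever end points belong to
    it. *)
Lemma uniform_itv k (b1 b2 : bool) u v : 0 <= u -> u <= v -> v <= 1 ->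
  pr P (Z k @^-1` [set` Interval (BSide b1 u) (BSide b2 v)]) = v - u.
Proof.
move=> u0 uv v1; apply: EFin_inj; rewrite -prE; last first.
  exact: measurable_preim.
have := @Zunif k [set` Interval (BSide b1 u) (BSide b2 v)] (measurable_itv _).
rewrite /distribution /pushforward => ->; rewrite /uniform_prob.
rewrite (eq_integral (fun=> 1%E)); last first.
  move=> x; rewrite inE/= itv_boundlr => /andP[ux xv].
  rewrite /uniform_pdf subr0 invr1.
  have -> : 0 <= x <= 1; last by [].
  apply/andP; split.
    by rewrite (le_trans u0)//; case: b1 ux; rewrite bnd_simp// => /ltW.
  by rewrite (le_trans _ v1)//; case: b2 xv; rewrite bnd_simp// => /ltW.
rewrite integral_cst//= mul1e.
have -> := lebesgue_measure_itv (Interval (BSide b1 u) (BSide b2 v)).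
rewrite /= lte_fin.
have [uv'|vu] := ltP u v; first by rewrite EFinB.
by have -> : v = u; [apply/le_anti/andP|rewrite subrr].
Qed.


Definition spin_sum k (w : T) : R := chi (fun j => Z j w) k.

Lemma spin_sumS k w : spin_sum k.+1 w = spin_sum k w + Z k w.
Proof. by rewrite /spin_sum /chi big_ord_recr. Qed.

Lemma measurable_spin_sum k : measurable_fun setT (spin_sum k).
Proof. by rewrite /spin_sum /chi; apply: measurable_sum. Qed.

(** A finite rectangle in the spins of index at least [k], the form to which [mutually_independent]
    applies directly. Since [spin_sum k] uses the indices below [k], it should be independent of
    such an event. *)
Definition tail_event k E := exists (J : seq nat) (B : nat -> set R),
  [/\ uniq J, {in J, forall i, (k <= i)%N}, forall i, measurable (B i) &
      E = \bigcap_(i in [set` J]) (Z i @^-1` B i)].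

Lemma tail_event_measurable k E : tail_event k E -> measurable E.
Proof.
move=> [J [B [_ _ mB ->]]]; rewrite bigcap_seq;
  apply: bigsetI_measurable => i _.
exact: measurable_preim.
Qed.

Lemma tail_eventT k : tail_event k setT.
Proof. by exists [::], (fun=> setT); split=> //;
  rewrite set_nil bigcap_set0. Qed.

(** The indices of [E] exceed [k], so [k] can be put in front of them and [B] overridden at [k];
    independence of the longer rectangle factors both sides. *)
Lemma tail_eventI k E C : tail_event k.+1 E -> measurable C ->
  tail_event k (Z k @^-1` C `&` E) /\
  pr P (Z k @^-1` C `&` E) = pr P (Z k @^-1` C) * pr P E.
Proof.
move=> [J [B [uJ kJ mB EE]]] mC.
pose B' i := if i == k then C else B i.
have mB' i : measurable (B' i) by rewrite /B'; case: ifP.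
have kNJ : k \notin J by apply/negP => /kJ; rewrite ltnn.
have JB' i : i \in J -> B' i = B i.
  by move=> iJ; rewrite /B'; case: eqP => // ik; rewrite -ik iJ in kNJ.
have B'k : B' k = C by rewrite /B' eqxx.
have ukJ : uniq (k :: J) by rewrite /= kNJ.
have EkJ : Z k @^-1` C `&` E = \bigcap_(i in [set` k :: J]) (Z i @^-1` B' i).
  rewrite EE !bigcap_seq big_cons B'k; congr (_ `&` _).
  by apply: eq_big_seq => i /JB' ->.
split.
  exists (k :: J), B'; split=> // i; rewrite inE => /predU1P[->//|/kJ].
  exact: ltnW.
rewrite EkJ pr_indep// EE pr_indep// big_cons B'k; congr (_ * _).
by apply: eq_big_seq => i /JB' ->.
Qed.

(** Spins lie in [[0, 1]] only almost surely; the half-line adds a null event to the interval from 0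
    to [x]. *)
Lemma pr_spin_lt k x : 0 <= x <= 1 -> pr P (Z k @^-1` `]-oo, x[) = x.
Proof.
case/andP=> x0 x1.
have spin01 : pr P (~` (Z k @^-1` `[0, 1])) = 0.
  rewrite prC; last exact: measurable_preim.
  by rewrite (@uniform_itv k true false) ?subr0 ?subrr.
apply/le_anti/andP; split; last first.
  rewrite -[leLHS]subr0 -(@uniform_itv k true true 0 x)//.
  by apply: pr_mono; [exact: measurable_preim..|move=> w /=;
    rewrite !in_itv/= => /andP[]].
rewrite -[leRHS]subr0 -(@uniform_itv k true true 0 x)// -[leRHS]addr0 -[X in _
  <= _ + X]spin01.
apply: pr_leU; [exact: measurable_preim| |exact: measurable_preim|].
  by apply: measurableC; exact: measurable_preim.
move=> w /=; rewrite !in_itv/= => ->; rewrite andbT.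
by have [w0|w0] := boolP (0 <= Z k w); [left|right].
Qed.

Lemma pr_spin_lt0 k : pr P [set w | Z k w < 0] = 0.
Proof.
have <- : Z k @^-1` `]-oo, 0[ = [set w | Z k w < 0].
  by apply/seteqP; split=> w /=; rewrite in_itv.
by rewrite pr_spin_lt// lexx ler01.
Qed.

(* The event [E] about later spins carries along the independence of the partial
   sum and the next spin, which the induction step needs. *)
Lemma pr_spin_sum_lt k E x : 0 <= x <= 1 -> tail_event k.+1 E ->
  pr P ([set w | spin_sum k.+1 w < x] `&` E) = pow_fact k.+1 x * pr P E.
Proof.
elim: k E x => [|k IH] E x x01 tE.
  have [_] := tail_eventI tE (measurable_itv `]-oo, x[).
  rewrite pr_spin_lt// /pow_fact expr1 divr1 => <-; congr (pr _ (_ `&` _)).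
  apply/seteqP; split=> w /=; rewrite in_itv/= spin_sumS.
    by rewrite /spin_sum /chi big_ord0 add0r.
  by rewrite /spin_sum /chi big_ord0 add0r.
case/andP: (x01) => x0 x1.
set S := spin_sum k.+1 in IH; set V := Z k.+1; set c := pr P E.
have mE := tail_event_measurable tE.
have mS : measurable_fun setT S by exact: measurable_spin_sum.
have mV : measurable_fun setT V by [].
set ev := [set w | spin_sum k.+2 w < x].
have mev : measurable ev by apply: measurable_lt; exact: measurable_spin_sum.
have mevE : measurable (ev `&` E) by exact: measurableI.
have c01 : 0 <= c <= 1 by rewrite pr_ge0 pr_le1.
have S0 : pr P [set w | S w < 0] = 0.
  have := IH setT 0; rewrite setIT /pow_fact expr0n mul0r mul0r; apply.
    by rewrite lexx ler01.
  exact: tail_eventT.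
apply: (@eq_of_dist_le_inv _ 1) => m m0.
have mR0 : 0 < m%:R :> R by rewrite ltr0n.
set e := x / m%:R; have e0 : 0 <= e by rewrite divr_ge0.
pose z l : R := l%:R * e.
have zS l : z l.+1 = z l + e by rewrite /z -natr1; ring.
have z_homo : {homo z : i j / (i <= j)%N >-> i <= j}.
  by move=> i j ij; rewrite ler_wpM2r// ler_nat.
have z0 : z 0%N = 0 by rewrite /z mul0r.
have zm : z m = x by rewrite /z /e mulrC divfK// gt_eqF.
have zx l : (l <= m)%N -> 0 <= x - z l <= 1.
  move=> lm; have h1 := z_homo _ _ lm; have h0 := z_homo _ _ (leq0n l).
  by rewrite zm in h1; rewrite z0 in h0; lra.
(* The condition that the next spin [V] falls into cell [l] is absorbed into the tail event, so the
   induction hypothesis covers it. *)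
have IHl l y : (l < m)%N -> 0 <= y <= 1 ->
    pr P ([set w | S w < y] `&` (V @^-1` `[z l, z l.+1[ `&` E)) =
    pow_fact k.+1 y * (e * c).
  move=> lm y01; have [tI prI] := tail_eventI tE (measurable_itv `[z l, z
    l.+1[).
  have h0 := z_homo _ _ (leq0n l); have h1 := z_homo _ _ lm.
  rewrite z0 in h0; rewrite zm in h1.
  have prV : pr P (V @^-1` `[z l, z l.+1[) = e.
    rewrite (@uniform_itv k.+1 true true (z l) (z l.+1) h0).
    - by rewrite zS addrAC subrr add0r.
    - exact: z_homo.
    - exact: le_trans x1.
  by rewrite (IH _ _ y01 tI) prI prV.
pose f := pow_fact k.+1 : R -> R; pose F := pow_fact k.+2 : R -> R.
have f0 : f 0 = 0 by rewrite /f /pow_fact expr0n mul0r.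
have F0 : F 0 = 0 by rewrite /F /pow_fact expr0n mul0r.
have step l : (l < m)%N -> e * f (x - z l.+1) <= F (x - z l) - F (x - z l.+1) /\
    F (x - z l) - F (x - z l.+1) <= e * f (x - z l).
  move=> lm; have /andP[h _] := zx _ lm.
  have [] := @pow_fact_step R k.+1 (x - z l.+1) (x - z l).
    by rewrite h/= lerD2l lerN2 z_homo.
  by rewrite (_ : x - z l - (x - z l.+1) = e)//; rewrite zS; ring.
have grid := @pr_grid _ _ _ P V (ev `&` E) z m mV mevE z_homo.
pose gr l := pr P (ev `&` E `&` [set w | z l <= V w < z l.+1]).
have mSI y l : measurable ([set w | S w < y] `&` (V @^-1` `[z l, z l.+1[ `&`
  E)).
  apply: measurableI; first exact: measurable_lt.
  by apply: measurableI => //; exact: measurable_preim.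
have mgrid a b : measurable (ev `&` E `&` [set w | a <= V w < b]).
  by apply: measurableI => //; exact: measurable_co.
have fx : f x * c <= 1.
  have := pow_fact_le1 k.+1 x01; have := pow_fact_ge0 k.+1 x0; rewrite -/(f x).
  move=> ? ?; case/andP: c01 => ? ?; rewrite -[leRHS]mulr1.
  by apply: ler_pM.
have err : e * f x * c <= 1 / m%:R.
  rewrite /e -mulrA mulrAC ler_pM2r ?invr_gt0//.
  rewrite -[leRHS]mulr1; apply: ler_pM => //.
  by case/andP: c01 => c0 _; rewrite mulr_ge0// pow_fact_ge0.
rewrite -[pow_fact k.+2 x]/(F x); apply/andP; split.
  apply: (@le_trans _ _ (pr P (ev `&` E `&` [set w | z 0%N <= V w < z m])));
    last first.
    by apply: pr_mono => //; exact: subIsetl.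
  (* On a cell the lower and upper Riemann terms differ by a drop of [e * f (x - z l)]. Putting this
     quantity into [G] makes the error telescope as well, to at most [e * f x * c]. *)
  rewrite grid; pose G l := (F (x - z l) - e * f (x - z l)) * c.
  apply: (@le_trans _ _ (G 0%N - G m)).
    by rewrite /G z0 zm subr0 subrr f0 F0; lra.
  apply: (@sum_ge_telescope _ m gr G) => l lm.
  apply: (@le_trans _ _ (f (x - z l.+1) * (e * c))).
    have [_ h] := step _ lm; rewrite /G -mulrBl mulrA.
    by apply: ler_wpM2r; [case/andP: c01|lra].
  rewrite -(IHl l) ?zx//; apply: pr_mono => // w /= [Sw [Vw Ew]].
  move: Vw; rewrite in_itv/= => /andP[V1 V2].
  split; last by rewrite V1.
  by split=> //; rewrite /ev/= spin_sumS -/S -/V; lra.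
apply: (@le_trans _ _ (pr P (ev `&` E `&` [set w | z 0%N <= V w < z m]))).
  (* Off this null event, [S w + V w < x] forces [0 <= V w < x], so the grid catches the spin. *)
  have S0V0 : pr P ([set w | V w < 0] `|` [set w | S w < 0]) = 0.
    apply/le_anti; rewrite pr_ge0 andbT.
    apply: (le_trans (@pr_leU _ _ _ P [set w | V w < 0] [set w | S w < 0] _ _ _
      _ _)) => //.
    - exact: measurable_lt.
    - exact: measurable_lt.
    - by apply: measurableU; exact: measurable_lt.
    - by rewrite S0 pr_spin_lt0 addr0.
  rewrite -[leRHS]addr0 -[X in _ <= _ + X]S0V0; apply: pr_leU => //.
    by apply: measurableU; exact: measurable_lt.
  move=> w [evw Ew] /=; rewrite z0 zm.
  have [V0|V0] := ltP (V w) 0; first by right; left.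
  have [Sw0|Sw0] := ltP (S w) 0; first by right; right.
  left; split=> //; apply/andP; split=> //.
  by move: evw; rewrite /ev/= spin_sumS -/S -/V; lra.
rewrite grid; pose G l := (F (x - z l) + e * f (x - z l)) * c.
apply: (@le_trans _ _ (G 0%N - G m)); last first.
  by rewrite /G z0 zm subr0 subrr f0 F0; lra.
apply: (@sum_le_telescope _ m gr G) => l lm.
apply: (@le_trans _ _ (f (x - z l) * (e * c))); last first.
  have [h _] := step _ lm; rewrite /G -mulrBl mulrA.
  by apply: ler_wpM2r; [case/andP: c01|lra].
rewrite -(IHl l) ?zx ?(ltnW lm)//;
  apply: pr_mono => // w /= [[evw Ew] /andP[V1 V2]].
split; first by move: evw; rewrite /ev/= spin_sumS -/S -/V; lra.
by split=> //; rewrite in_itv/= V1.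
Qed.

End Spins.

(** * The jump over the threshold *)

Section Jump.
Set Implicit Arguments.
Unset Strict Implicit.
Context {R : realType} {d : measure_display} {T : measurableType d}.
Variables (P : probability T R) (Z : nat -> {RV P >-> R}).
Hypothesis Zunif : forall k, uniform01 (Z k).
Hypothesis Zindep : mutually_independent Z.
Implicit Types (C : set R) (x y u v tau a : R).

Let S k := spin_sum Z k.

(** The difference of [pr_spin_sum_lt] at [v] and [u], the tail event being a condition on [Z k.+1],
    the first spin not included in [S k.+1]. *)
Lemma pr_spin_sum_co k C u v : 0 <= u -> u <= v -> v <= 1 -> measurable C ->
  pr P ([set w | u <= S k.+1 w < v] `&` Z k.+1 @^-1` C) =
  (pow_fact k.+1 v - pow_fact k.+1 u) * pr P (Z k.+1 @^-1` C).
Proof.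
move=> u0 uv v1 mC; have mS := measurable_spin_sum Z k.+1.
have mZ : measurable (Z k.+1 @^-1` C) by exact: measurable_preim.
have tC : tail_event Z k.+1 (Z k.+1 @^-1` C).
  by rewrite -[X in tail_event _ _ X]setIT;
    case: (tail_eventI Zindep (tail_eventT Z k.+2) mC).
have lt y : 0 <= y <= 1 -> pr P ([set w | S k.+1 w < y] `&` Z k.+1 @^-1` C) =
    pow_fact k.+1 y * pr P (Z k.+1 @^-1` C).
  by move=> y01; rewrite pr_spin_sum_lt.
rewrite mulrBl -!lt ?(le_trans u0)// ?u0 ?(le_trans uv)//.
apply/eqP; rewrite eq_sym subr_eq; apply/eqP.
rewrite -prU//.
- congr (pr P _); rewrite -setIUl; congr (_ `&` _); apply/seteqP; split=> w /=.
    by move=> Sv; have [Su|Su] := ltP (S k.+1 w) u; [right|left].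
  by case=> [/andP[]//|/lt_le_trans]; exact.
- by apply: measurableI => //; exact: measurable_co.
- by apply: measurableI => //; exact: measurable_lt.
- apply/seteqP; split=> // w [[/andP[h1 _] _] [h2 _]].
  by have := le_lt_trans h1 h2; rewrite ltxx.
Qed.

(** From a sum [s < tau] the next spin must fall into [[a - s, 1 - s]]. As [tau <= a], for [s >= 0]
    this window lies in [[0, 1]] and its length [1 - a] does not depend on [s], so the probability
    factors. *)
Lemma pr_spin_sum_jump k tau a : 0 <= tau -> tau <= a -> a <= 1 ->
  pr P ([set w | a <= S k.+2 w <= 1] `&` [set w | S k.+1 w < tau]) =
  (1 - a) * pow_fact k.+1 tau.
Proof.
move=> tau0 taua a1; have tau1 := le_trans taua a1.
have mS : measurable_fun setT (S k.+1) by exact: measurable_spin_sum.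
set ev := [set w | a <= S k.+2 w <= 1].
have mev : measurable ev by apply: measurable_cc; exact: measurable_spin_sum.
pose f := pow_fact k.+1 : R -> R.
have f0 : f 0 = 0 by rewrite /f /pow_fact expr0n mul0r.
have S0 : pr P [set w | S k.+1 w < 0] = 0.
  rewrite -[X in pr P X]setIT pr_spin_sum_lt ?lexx ?ler01//;
    last exact: tail_eventT.
  by rewrite -/(f 0) f0 mul0r.
apply: (@eq_of_dist_le_inv _ 1) => m m0.
have mR0 : 0 < m%:R :> R by rewrite ltr0n.
set e := tau / m%:R; have e0 : 0 <= e by rewrite divr_ge0.
have em : e <= 1 / m%:R by rewrite /e ler_pM2r ?invr_gt0.
pose z l : R := l%:R * e.
have zS l : z l.+1 = z l + e by rewrite /z -natr1; ring.
have z_homo : {homo z : i j / (i <= j)%N >-> i <= j}.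
  by move=> i j ij; rewrite ler_wpM2r// ler_nat.
have z0 : z 0%N = 0 by rewrite /z mul0r.
have zm : z m = tau by rewrite /z /e mulrC divfK// gt_eqF.
have z_ge0 l : 0 <= z l by rewrite -z0 z_homo.
have z_tau l : (l <= m)%N -> z l <= tau by move=> lm; rewrite -zm z_homo.
have fmono l : f (z l) <= f (z l.+1).
  by rewrite ler_pM2r ?invr_gt0 ?ltr0n ?fact_gt0// lerXn2r ?nnegrE ?z_homo.
have ftau : 0 <= f tau <= 1 by rewrite pow_fact_ge0// pow_fact_le1// tau0.
have err : f tau * e <= 1 / m%:R.
  apply: le_trans em; case/andP: ftau => h0 h1.
  by rewrite -[leRHS]mul1r ler_wpM2r.
have co l C : (l < m)%N -> measurable C ->
    pr P ([set w | z l <= S k.+1 w < z l.+1] `&` Z k.+1 @^-1` C) =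
    (f (z l.+1) - f (z l)) * pr P (Z k.+1 @^-1` C).
  move=> lm mC; rewrite pr_spin_sum_co//; first exact: z_homo.
  exact: le_trans (z_tau _ lm) tau1.
have grid := @pr_grid _ _ _ P (S k.+1) ev z m mS mev z_homo.
pose gr l := pr P (ev `&` [set w | z l <= S k.+1 w < z l.+1]).
have mgrid x y : measurable (ev `&` [set w | x <= S k.+1 w < y]).
  by apply: measurableI => //; exact: measurable_co.
have mco x y C : measurable C ->
    measurable ([set w | x <= S k.+1 w < y] `&` Z k.+1 @^-1` C).
  move=> mC; apply: measurableI; first exact: measurable_co.
  exact: measurable_preim.
have mevS : measurable (ev `&` [set w | S k.+1 w < tau]).
  by apply: measurableI => //; exact: measurable_lt.
rewrite -[pow_fact k.+1 tau]/(f tau); apply/andP; split.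
  apply: (@le_trans _ _ (pr P (ev `&` [set w | z 0%N <= S k.+1 w < z m])));
    last first.
    by apply: pr_mono => // w [evw /andP[_ h]]; split=> //=; rewrite -zm.
  rewrite grid; pose G l := - f (z l) * (1 - a - e).
  apply: (@le_trans _ _ (G 0%N - G m)); first by rewrite /G z0 zm f0; lra.
  apply: (@sum_ge_telescope _ m gr G) => l lm.
  rewrite (_ : G l - G l.+1 = (f (z l.+1) - f (z l)) * (1 - a - e)); last first.
    by rewrite /G; ring.
  (* The window that suits every sum of the cell has length [1 - a - e]; when this is negative there
     is no such window and the bound by 0 suffices. *)
  have [neg|pos] := ltP (1 - a - e) 0.
    apply: (@le_trans _ _ 0); last exact: pr_ge0.
    by rewrite mulr_ge0_le0 ?(ltW neg)// subr_ge0.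
  have prV : pr P (Z k.+1 @^-1` `[a - z l, 1 - z l.+1]) = 1 - a - e.
    rewrite (@uniform_itv _ _ _ _ _ Zunif k.+1 true false).
    - by rewrite zS; ring.
    - by rewrite subr_ge0 (le_trans (z_tau _ (ltnW lm))).
    - by rewrite zS; lra.
    - by have := z_ge0 l.+1; lra.
  rewrite -prV -co//; apply: pr_mono;
    [exact: mco|exact: mgrid|] => w /= [/andP[S1 S2]].
  rewrite in_itv/= => /andP[V1 V2]; split; last by rewrite S1.
  by rewrite /ev/= /S spin_sumS -/(S k.+1); lra.
apply: (@le_trans _ _ (pr P (ev `&` [set w | z 0%N <= S k.+1 w < z m]))).
  rewrite -[leRHS]addr0 -[X in _ <= _ + X]S0; apply: pr_leU => //.
    exact: measurable_lt.
  move=> w [evw Sw]; rewrite z0 zm.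
  have [S0w|S0w] := ltP (S k.+1 w) 0; first by right.
  by left; split=> //=; rewrite S0w.
rewrite grid; pose G l := - f (z l) * (1 - a + e).
apply: (@le_trans _ _ (G 0%N - G m)); last by rewrite /G z0 zm f0; lra.
apply: (@sum_le_telescope _ m gr G) => l lm.
rewrite (_ : G l - G l.+1 = (f (z l.+1) - f (z l)) * (1 - a + e)); last first.
  by rewrite /G; ring.
(* The window is enlarged to contain those of all sums in the cell; [z l.+1 <= tau <= a] keeps it in
   [[0, 1]]. *)
have prV : pr P (Z k.+1 @^-1` `[a - z l.+1, 1 - z l]) = 1 - a + e.
  rewrite (@uniform_itv _ _ _ _ _ Zunif k.+1 true false).
  - by rewrite zS; ring.
  - by rewrite subr_ge0 (le_trans (z_tau _ lm)).
  - by rewrite zS; lra.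
  - by have := z_ge0 l; lra.
rewrite -prV -co//; apply: pr_mono;
  [exact: mgrid|exact: mco|] => w /= [evw /andP[S1 S2]].
split; first by rewrite S1.
by move: evw; rewrite /ev/= /S spin_sumS -/(S k.+1) in_itv/=; lra.
Qed.

End Jump.

(** * The law of the score *)

Section Score.
Set Implicit Arguments.
Unset Strict Implicit.
Context {R : realType} {d : measure_display} {T : measurableType d}.
Variables (P : probability T R) (Z : nat -> {RV P >-> R}).
Hypothesis Zunif : forall k, uniform01 (Z k).
Hypothesis Zindep : mutually_independent Z.
Implicit Types (x tau a : R) (z : nat -> R).

Lemma score_itv tau z : 0 <= tau -> 0 <= score tau z <= 1.
Proof.
move=> tau0; rewrite /score; case: pselect => [reach|_];
  last by rewrite lexx ler01.
case: ex_minnP => N /andP[_ tauN] _; case: ifPn => [->|_].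
  by rewrite (le_trans tau0).
by rewrite lexx ler01.
Qed.

(** For [tau <= a]: the stopping time is [k.+1] and the score lies in [[a, 1]]. The index counts the
    spins before the last one. *)
Definition stop_at tau a k : set T :=
  [set w | (forall j, (j < k)%N -> spin_sum Z j.+1 w < tau) /\
           a <= spin_sum Z k.+1 w <= 1].

(** A positive score is a stopped sum, hence at least [tau], which explains the maximum. Positivity
    of [x] discards both the busts and the sequences that never reach [tau]. *)
Lemma score_ge_bigcup tau x : 0 < x ->
  [set w | x <= score tau (fun k => Z k w)] =
  \bigcup_k stop_at tau (Num.max x tau) k.
Proof.
move=> x0; apply/seteqP; split=> w /=.
  rewrite /score; case: pselect => [reach|_]; last by rewrite leNgt x0.
  case: ex_minnP => -[|N]; first by rewrite /reached.
  move=> /andP[_ tauN] minN; case: ifPn => [N1 xN|_]; last by rewrite leNgt x0.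
  exists N => //; split; last by rewrite ge_max xN tauN.
  move=> j jN; rewrite ltNge; apply/negP => tauj.
  by have := minN j.+1; rewrite /reached tauj => /(_ isT);
    rewrite leqNgt ltnS jN.
move=> [k _ [before]]; rewrite ge_max => /andP[/andP[xk tauk] k1].
rewrite /score; case: pselect => [reach|]; last first.
  by case; exists k.+1; rewrite /reached tauk.
case: ex_minnP => N /andP[N0 tauN] minN.
have -> : N = k.+1.
  apply/eqP; rewrite eqn_leq minN /reached ?tauk//=.
  rewrite ltnNge; apply/negP => Nk; case: N N0 tauN Nk {minN} => // N _ tauN Nk.
  by have := before _ Nk; rewrite ltNge => /negP; exact.
by rewrite k1.
Qed.

Lemma stop_at_measurable tau a k : measurable (stop_at tau a k).
Proof.
rewrite (_ : stop_at tau a k =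
    \bigcap_(j < k) [set w | spin_sum Z j.+1 w < tau] `&`
    [set w | a <= spin_sum Z k.+1 w <= 1]); last first.
  by apply/seteqP; split=> w [].
apply: measurableI; last first.
  by apply: measurable_cc; exact: measurable_spin_sum.
rewrite bigcap_mkord; apply: bigsetI_measurable => j _.
by apply: measurable_lt; exact: measurable_spin_sum.
Qed.

Lemma stop_at_trivIset tau a : tau <= a -> trivIset setT (stop_at tau a).
Proof.
move=> taua; apply/trivIsetP => i j _ _ ij.
wlog ltij : i j ij / (i < j)%N.
  move=> h; move: (ij); rewrite neq_ltn => /orP[|] ltij; first exact: h.
  by rewrite setIC; apply: h => //; rewrite eq_sym.
apply/seteqP; split=> // w [[_ /andP[ai _]] [/(_ _ ltij) lti _]].
by have := le_lt_trans (le_trans taua ai) lti; rewrite ltxx.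
Qed.

Lemma pr_some_spin_lt0 : pr P (\bigcup_k [set w | Z k w < 0]) = 0.
Proof.
have mneg k : measurable [set w | Z k w < 0] by exact: measurable_lt.
apply: EFin_inj; rewrite -prE; last exact: bigcupT_measurable.
apply/le_anti; rewrite measure_ge0 andbT.
rewrite (@le_trans _ _ (\sum_(k <oo) P [set w | (Z k w < 0)%R])%E)//.
  by apply: measure_sigma_subadditive => //; exact: bigcupT_measurable.
by rewrite eseries0// => k _ _; rewrite prE// pr_spin_lt0.
Qed.

(** Almost surely no spin is negative, so the partial sums are nondecreasing and only the last one
    before the stop has to be compared with [tau]: this is the event of [pr_spin_sum_jump]. For
    [k = 0] the first spin alone decides. *)
Lemma pr_stop_at tau a k : 0 <= tau -> tau <= a -> a <= 1 ->
  pr P (stop_at tau a k) = (1 - a) * pow_fact k tau.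
Proof.
move=> tau0 taua a1; case: k => [|k].
  rewrite /pow_fact expr0 divr1 mulr1.
  rewrite -(@uniform_itv _ _ _ _ _ Zunif 0 true false a 1)// ?(le_trans tau0)//.
  have S1 w : spin_sum Z 1 w = Z 0%N w by rewrite spin_sumS /spin_sum /chi
    big_ord0 add0r.
  congr (pr P _); apply/seteqP; split=> w; rewrite /stop_at/= in_itv/= S1.
    by case.
  by move=> ->; split.
have mSt := measurable_lt tau (measurable_spin_sum Z k.+1).
have mS : measurable [set w | a <= spin_sum Z k.+2 w <= 1].
  by apply: measurable_cc; exact: measurable_spin_sum.
rewrite -(pr_spin_sum_jump Zunif Zindep)//; apply/le_anti/andP; split.
  apply: pr_mono; [exact: stop_at_measurable|exact: measurableI|].
  by move=> w [before h]; split=> //; exact: before.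
rewrite -[leRHS]addr0 -[X in _ <= _ + X]pr_some_spin_lt0.
apply: pr_leU; [exact: stop_at_measurable| |exact: measurableI|].
  by apply: bigcupT_measurable => i; exact: measurable_lt.
move=> w [h Sk]; have [[i neg]|nonneg] := pselect (exists i, Z i w < 0).
  by right; exists i.
left; split=> // j jk; apply: le_lt_trans Sk.
have S_homo : {homo (fun i => spin_sum Z i w) : i j / (i <= j)%N >-> i <= j}.
  apply: homo_leq => // [? ? ?|i]; first exact: le_trans.
  rewrite spin_sumS lerDl leNgt; apply/negP => neg; apply: nonneg.
  by exists i.
by apply: S_homo; rewrite ltnS -ltnS.
Qed.

Lemma pr_score_ge tau x : 0 <= tau <= 1 -> 0 < x <= 1 ->
  pr P [set w | x <= score tau (fun k => Z k w)] =
  expR tau * (1 - Num.max x tau).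
Proof.
case/andP=> tau0 tau1 /andP[x0 x1]; set a := Num.max x tau.
have taua : tau <= a by rewrite le_max lexx orbT.
have a1 : a <= 1 by rewrite ge_max x1.
rewrite score_ge_bigcup// -/a; apply: EFin_inj.
have mD k : setT k -> measurable (stop_at tau a k) by move=> _;
  exact: stop_at_measurable.
rewrite -prE; last by apply: bigcup_measurable.
rewrite measure_bigcup//; last exact: stop_at_trivIset.
(* [pow_fact k tau] is the general term of the exponential series at [tau]. *)
rewrite (eq_eseriesr (g := fun k => ((1 - a) * exp_coeff tau k)%:E));
  last first.
  move=> k _; rewrite -[LHS]/(P (stop_at tau a k)) prE;
    last exact: stop_at_measurable.
  by rewrite pr_stop_at.
rewrite (_ : (fun n => _) = EFin \o series ((1 - a) *: exp_coeff tau));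
  last first.
  by apply/funext => n /=; rewrite sumEFin; congr EFin; apply: eq_bigl => k;
    rewrite in_setT.
rewrite EFin_lim; last exact/is_cvg_seriesZ/is_cvg_series_exp_coeff.
rewrite lim_seriesZ; last exact: is_cvg_series_exp_coeff.
by rewrite mulrC.
Qed.

End Score.

(** * The distribution function of a score *)

Section ScoreLaw.
Set Implicit Arguments.
Unset Strict Implicit.
Context {R : realType} {d : measure_display} {T : measurableType d}.
Variable P : probability T R.
Implicit Types (X : {RV P >-> R}) (t x u v : R).

Definition score_cdf t x : R := 1 - expR t * (1 - Num.max x t).

(** An atom of mass [bust t] at 0 and the constant density [expR t] on [[t, 1]]. *)
Definition score_law X t : Prop :=
  [/\ pr P [set w | X w < 0] = 0, pr P [set w | X w = 0] = bust t &
      forall x, 0 < x <= 1 -> pr P [set w | X w < x] = score_cdf t x].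

Lemma measurable_eq0 X : measurable [set w | X w = 0].
Proof.
rewrite (_ : [set w | X w = 0] = X @^-1` [set 0]); last by [].
exact: measurable_preim.
Qed.

Lemma measurable_lt2 (X Y : T -> R) : measurable_fun setT X -> measurable_fun
  setT Y ->
  measurable [set w | X w < Y w].
Proof.
move=> mX mY; rewrite (_ : [set w | _] = [set w | X w - Y w < 0]).
  by apply: measurable_lt; exact: measurable_funB.
by apply/seteqP; split=> w /=; rewrite subr_lt0.
Qed.

Lemma measurable_gt0 X : measurable [set w | 0 < X w].
Proof. by apply: (measurable_lt2 (X := fun=> 0)). Qed.

Lemma score_law_co X t u v : score_law X t -> 0 < u -> u <= v -> v <= 1 ->
  pr P [set w | u <= X w < v] = expR t * (Num.max v t - Num.max u t).
Proof.
move=> [_ _ cdfX] u0 uv v1.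
have -> : [set w | u <= X w < v] = [set w | X w < v] `\` [set w | X w < u].
  apply/seteqP; split=> w /=.
    by case/andP=> uX ->; split=> //; apply/negP; rewrite -leNgt.
  by case=> -> /negP; rewrite -leNgt => ->.
rewrite prDI; [|exact: measurable_lt..].
have -> : [set w | X w < v] `&` [set w | X w < u] = [set w | X w < u].
  by apply/setIidr => w /= /lt_le_trans; exact.
rewrite !cdfX ?u0 ?(lt_le_trans u0)//= ?(le_trans uv)//.
by rewrite /score_cdf; ring.
Qed.

Lemma score_law_gt0 X t v : score_law X t -> 0 < v <= 1 ->
  pr P [set w | 0 < X w < v] <= expR t * (Num.max v t - t).
Proof.
move=> [X0 Xbust cdfX] v01; have v0 : 0 < v by case/andP: v01.
have mX := measurable_eq0 X.
have mpos : measurable [set w | 0 < X w < v].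
  rewrite (_ : [set w | _] = [set w | 0 < X w] `&` [set w | X w < v]).
    by apply: measurableI; [exact: measurable_gt0|exact: measurable_lt].
  by apply/seteqP; split=> w /= /andP.
rewrite (_ : expR t * (Num.max v t - t) = score_cdf t v - bust t); last first.
  by rewrite /score_cdf /bust; ring.
rewrite lerBrDr -Xbust -cdfX// -prU//; last first.
  by apply/seteqP; split=> // w /= [/andP[+ _] Xw0]; rewrite Xw0 ltxx.
apply: pr_mono; [exact: measurableU|exact: measurable_lt|].
by move=> w /= [/andP[]|->].
Qed.

(** The density is at most [expR t]. The condition [0 < X w] removes the atom, and [u = 0] is
    treated apart because the distribution function is given only at positive points. *)
Lemma score_law_pos_co X t u v : 0 <= t -> score_law X t -> 0 <= u -> u <= v ->
  v <= 1 ->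
  pr P ([set w | 0 < X w] `&` [set w | u <= X w < v]) <= expR t * (v - u).
Proof.
move=> t0 lawX u0 uv v1.
have mI : measurable ([set w | 0 < X w] `&` [set w | u <= X w < v]).
  by apply: measurableI; [exact: measurable_gt0|exact: measurable_co].
have max_lip w : w <= v -> Num.max v t - Num.max w t <= v - w.
  by move=> wv; have [] := leP v t; have [] := leP w t; lra.
move: u0; rewrite le_eqVlt => /predU1P[u0|u0].
  move: uv; rewrite -u0 subr0 le_eqVlt => /predU1P[v0|v0].
    rewrite -v0 mulr0 (_ : _ `&` _ = set0) ?pr_set0//.
    by apply/seteqP; split=> // w /= [_ /andP[/le_lt_trans h /h]]; rewrite ltxx.
  apply: (@le_trans _ _ (pr P [set w | 0 < X w < v])).
    rewrite (_ : [set w | 0 < X w < v] = [set w | 0 < X w] `&` [set w | u <= X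
      w < v]) ?u0//.
    apply/seteqP; split=> w /=; rewrite -u0; first by case/andP=> h ->;
      rewrite ltW.
    by case=> -> /andP[].
  apply: (le_trans (score_law_gt0 lawX _)); first by rewrite v0.
  by rewrite ler_pM2l ?expR_gt0//; have [] := leP v t; lra.
apply: (@le_trans _ _ (pr P [set w | u <= X w < v])).
  by apply: pr_mono => //; exact: measurable_co.
by rewrite (score_law_co lawX)// ler_pM2l ?expR_gt0// max_lip.
Qed.

Lemma score_law_ge1 X t : t <= 1 -> score_law X t -> pr P [set w | 1 <= X w] =
  0.
Proof.
move=> t1 [_ _ cdfX]; rewrite (_ : [set w | _] = ~` [set w | X w < 1]);
  last first.
  by apply/seteqP; split=> w /=; [move=> ?; apply/negP|move/negP];
    rewrite -leNgt.
rewrite prC; last exact: measurable_lt.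
by rewrite cdfX ?ltr01 ?lexx// /score_cdf (max_idPl t1); ring.
Qed.

End ScoreLaw.

Section GameScores.
Set Implicit Arguments.
Unset Strict Implicit.
Context {R : realType} {d0 : measure_display} {T0 : measurableType d0}.
Context {d : measure_display} {T : measurableType d}.
Variables (P0 : probability T0 R) (Z : nat -> {RV P0 >-> R}).
Variables (P : probability T R) (n : nat) (xi : 'I_n -> R -> {RV P >-> R}).
Hypothesis Zunif : forall k, uniform01 (Z k).
Hypothesis Zindep : mutually_independent Z.
Hypothesis Hxi : game_scores Z xi.

Lemma game_scores_law i t : 0 <= t <= 1 -> score_law (xi i t) t.
Proof.
move=> t01; case/andP: (t01) => t0 t1.
pose sc w := score t (fun k => Z k w).
(* Probabilities of the game score are computed in the space of the spins. *)
have tr (B : set R) : measurable B -> pr P (xi i t @^-1` B) = pr P0 (sc @^-1`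
  B).
  by move=> mB; rewrite /pr -(proj1 Hxi i t t01 B mB).
have sc01 w : 0 <= sc w <= 1 by exact: score_itv.
have ge x : 0 < x <= 1 -> pr P [set w | x <= xi i t w] = expR t * (1 - Num.max
  x t).
  move=> x01; rewrite -(pr_score_ge Zunif Zindep t01 x01).
  by apply: (tr [set y | x <= y]); apply: measurable_ge; exact: measurable_id.
have lt x : 0 < x <= 1 -> pr P [set w | xi i t w < x] = score_cdf t x.
  move=> x01; rewrite /score_cdf -ge// -prC; last exact: measurable_ge.
  congr (pr P _); apply/seteqP; split=> w /=.
    by rewrite ltNge => /negP.
  by move/negP; rewrite -ltNge.
have lt0 : pr P [set w | xi i t w < 0] = 0.
  rewrite (tr [set y | y < 0]); last by apply: measurable_lt;
    exact: measurable_id.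
  rewrite (_ : _ @^-1` _ = set0) ?pr_set0//.
  by apply/seteqP; split=> // w /=; rewrite ltNge; case/andP: (sc01 w) => ->.
have mxi := measurable_eq0 (xi i t).
split=> //; apply/le_anti/andP; split.
  (* A zero score is below [1 / m], an event whose probability exceeds [bust t] by at most
     [expR t / m]. *)
  apply: (@le_of_le_add_inv _ (expR t)) => m m0.
  have m01 : 0 < (m%:R^-1 : R) <= 1 by rewrite invr_gt0 ltr0n m0 invf_le1
    ?ltr0n// ler1n.
  apply: (@le_trans _ _ (pr P [set w | xi i t w < m%:R^-1])).
    apply: pr_mono => //; first exact: measurable_lt.
    by move=> w /= ->; case/andP: m01.
  rewrite lt// /score_cdf /bust; case/andP: m01 => h _.
  rewrite -lerBlDl; set e := m%:R^-1 in h *.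
  rewrite (_ : _ - _ - _ = expR t * (Num.max e t - t)); last by ring.
  by rewrite ler_pM2l ?expR_gt0//; have [] := leP e t; lra.
(* For [t > 0] the lower bound is an equality of events: a score below the threshold is 0. *)
have [->|tn0] := eqVneq t 0; first by rewrite bust0 pr_ge0.
have {}t0 : 0 < t by rewrite lt_neqAle eq_sym tn0.
have -> : bust t = pr P [set w | xi i t w < t].
  by rewrite lt ?t0// /score_cdf maxxx.
rewrite (tr [set y | y < t]); last by apply: measurable_lt;
  exact: measurable_id.
have -> : pr P [set w | xi i t w = 0] = pr P0 (sc @^-1` [set 0]).
  by rewrite -tr.
rewrite (_ : sc @^-1` [set y | y < t] = sc @^-1` [set 0])//.
apply/seteqP; split=> w /=; last by move=> ->.
rewrite /sc /score; case: pselect => // reach.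
case: ex_minnP => N /andP[_ tN] _; case: ifP => //.
by rewrite ltNge tN.
Qed.

End GameScores.

(** * Winning probabilities *)

Section Profile.
Set Implicit Arguments.
Unset Strict Implicit.
Context {R : realType} {d : measure_display} {T : measurableType d}.
Variables (P : probability T R) (n : nat) (X : 'I_n -> {RV P >-> R}).
Variable kappa : 'I_n -> R.
Hypothesis kappa01 : admissible kappa.
Hypothesis lawX : forall i, score_law (X i) (kappa i).
Hypothesis indepX : mutually_independent X.
Implicit Types (i j : 'I_n).

Definition win_event i : set T := [set w | wins (fun j => X j w) i].
Definition all_zero : set T := [set w | forall i, X i w = 0].

Lemma winsE w i : win_event i w <-> 0 < X i w /\ forall j, j != i -> X j w < X
  i w.
Proof.
rewrite /win_event/= /wins; split=> [/andP[-> /forallP h]|[-> h]].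
  by split=> // j ji; have /implyP := h j; exact.
by apply/forallP => j; apply/implyP; exact: h.
Qed.

Lemma measurable_forall (I : finType) (F : I -> set T) :
  (forall k, measurable (F k)) -> measurable [set w | forall k, F k w].
Proof.
move=> mF; rewrite (_ : [set w | _] = \big[setI/setT]_(k <- index_enum I) F k).
  by apply: bigsetI_measurable => k _.
rewrite -bigcap_seq; apply/seteqP; split=> w h k; first by move=> _; exact: h.
by apply: h; rewrite /= mem_index_enum.
Qed.

Lemma win_event_measurable i : measurable (win_event i).
Proof.
rewrite (_ : win_event i = [set w | 0 < X i w] `&`
    [set w | forall j, (if j == i then setT else [set w | X j w < X i w]) w]).
  apply: measurableI; first exact: measurable_gt0.
  by apply: measurable_forall => j; case: ifP => // _; exact: measurable_lt2.
apply/seteqP; split=> w.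
  by move=> /winsE[h1 h2]; split=> //= j; case: ifPn => // /h2.
move=> [h1 h2]; apply/winsE; split=> // j ji.
by have := h2 j; rewrite /= (negbTE ji).
Qed.

Lemma all_zero_measurable : measurable all_zero.
Proof. by apply: measurable_forall => i; exact: measurable_eq0. Qed.

Lemma pr_all_zero : pr P all_zero = \prod_i bust (kappa i).
Proof.
have := @pr_indep _ _ _ P _ X (index_enum 'I_n) (fun=> [set 0]) indepX
  (index_enum_uniq _) (fun=> measurable_set1 _).
rewrite (_ : \bigcap_(i in _) _ = all_zero) => [->|].
  by apply: eq_bigr => i _; have [_ <- _] := lawX i.
apply/seteqP; split=> w h i; first by apply: h; rewrite /= mem_index_enum.
by move=> _; exact: h.
Qed.

Lemma pr_bigsetU0 (I : Type) (s : seq I) (N : I -> set T) :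
  (forall k, measurable (N k)) -> (forall k, pr P (N k) = 0) ->
  pr P (\big[setU/set0]_(k <- s) N k) = 0.
Proof.
move=> mN N0; elim: s => [|k s IH]; first by rewrite big_nil pr_set0.
have mU : measurable (\big[setU/set0]_(l <- s) N l) by exact:
  bigsetU_measurable.
rewrite big_cons; apply/le_anti; rewrite pr_ge0 andbT.
rewrite -[leRHS]addr0 -[X in _ <= X + _](N0 k) -[X in _ <= _ + X]IH.
by apply: pr_leU => //; exact: measurableU.
Qed.

(** Ties at 0 are left out: 0 is in general an atom of both scores. *)
Definition tie_event i j : set T := [set w | 0 < X i w] `&` [set w | X i w = X
  j w].

Lemma tie_event_measurable i j : measurable (tie_event i j).
Proof.
apply: measurableI; first exact: measurable_gt0.
rewrite (_ : [set w | _] = ~` ([set w | X i w < X j w] `|` [set w | X j w < X i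
  w])).
  by apply: measurableC; apply: measurableU; exact: measurable_lt2.
apply/seteqP; split=> w /=; first by move=> ->; rewrite ltxx => -[].
by move=> h; have [hlt|hlt|//] := ltgtP (X i w) (X j w); case: h; [left|right].
Qed.

Lemma pr_indep2 i j (A B : set R) : i != j -> measurable A -> measurable B ->
  pr P (X i @^-1` A `&` X j @^-1` B) = pr P (X i @^-1` A) * pr P (X j @^-1` B).
Proof.
move=> ij mA mB; pose C k := if k == i then A else B.
have mC k : measurable (C k) by rewrite /C; case: ifP.
have uij : uniq [:: i; j] by rewrite /= inE ij.
have Ci : C i = A by rewrite /C eqxx.
have Cj : C j = B by rewrite /C eq_sym (negbTE ij).
by have := pr_indep indepX uij mC;
  rewrite bigcap_seq !big_cons !big_nil setIT mulr1 Ci Cj.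
Qed.

(** A tie puts both scores into the same of [m] cells. Player [i] hits a given cell at a positive
    score with probability at most [expR t / m], and the probabilities that [j] is in the various
    cells sum to at most 1. *)
Lemma pr_tie i j : i != j -> pr P (tie_event i j) = 0.
Proof.
move=> ij; have /andP[k0 k1] := kappa01 i; set t := kappa i in k0 k1.
have mtie := tie_event_measurable i j.
apply/le_anti; rewrite pr_ge0 andbT;
  apply: (@le_of_le_add_inv _ (expR t)) => m m0.
rewrite add0r; have mR0 : 0 < m%:R :> R by rewrite ltr0n.
pose z l : R := l%:R / m%:R.
have zS l : z l.+1 - z l = m%:R^-1 by rewrite /z -natr1; ring.
have z_homo : {homo z : i j / (i <= j)%N >-> i <= j}.
  by move=> a b ab; rewrite ler_wpM2r ?invr_ge0 ?ler_nat// ltW.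
have z0 : z 0%N = 0 by rewrite /z mul0r.
have zm : z m = 1 by rewrite /z divff// gt_eqF.
have mXi : measurable_fun setT (X i) by [].
have mXj : measurable_fun setT (X j) by [].
have mI k a b : measurable [set w | a <= X k w < b] by exact: measurable_co.
apply: (@le_trans _ _ (pr P (tie_event i j `&` [set w | z 0%N <= X i w < z
  m]))).
  have [Xi0 _ _] := lawX i.
  rewrite -[leRHS]addr0 -[X in _ <= _ + X](score_law_ge1 k1 (lawX i)).
  apply: pr_leU; [by apply: measurableI|exact: measurable_ge|by []|].
  move=> w tw; case: (tw) => /= X0 _; have [X1|X1] := leP 1 (X i w);
    first by right.
  by left; split=> //=; rewrite z0 zm X1 ltW.
rewrite (@pr_grid _ _ _ P (X i) _ z m mXi mtie z_homo).
pose Ij l := [set w | z l <= X j w < z l.+1].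
apply: (@le_trans _ _ (\sum_(l < m) expR t / m%:R * pr P (setT `&` Ij l))).
  apply: ler_sum => l _; rewrite setTI -(zS l).
  apply: (@le_trans _ _ (pr P (([set w | 0 < X i w] `&` [set w | z l <= X i w <
    z l.+1]) `&` Ij l))).
    apply: pr_mono; first by apply: measurableI.
      apply: measurableI; last exact: mI.
      by apply: measurableI; [exact: measurable_gt0|exact: mI].
    by move=> w [[h1 /= h2] /= h3]; split=> //; rewrite /Ij/= -h2.
  have := @pr_indep2 i j ([set y | 0 < y] `&` [set y | z l <= y < z l.+1])
    [set y | z l <= y < z l.+1] ij.
  rewrite preimage_setI => ->.
  - apply: ler_wpM2r; first exact: pr_ge0.
    apply: score_law_pos_co => //; first by rewrite -z0 z_homo.
      exact: z_homo.
    by rewrite -zm z_homo.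
  - apply: measurableI; last by apply: measurable_co; exact: measurable_id.
    by apply: (measurable_lt2 (X := fun=> 0)) => //; exact: measurable_id.
  - by apply: measurable_co; exact: measurable_id.
rewrite -mulr_sumr -(@pr_grid _ _ _ P (X j) _ z m mXj _ z_homo)//.
rewrite -[leRHS]mulr1; apply: ler_wpM2l.
  by rewrite divr_ge0 ?expR_ge0// ltW.
by apply: pr_le1; apply: measurableI => //; exact: mI.
Qed.

Definition some_win : set T := [set w | exists i, win_event i w].

Lemma some_winE : some_win = \big[setU/set0]_(i < n) win_event i.
Proof.
rewrite -bigcup_seq; apply/seteqP; split=> w [i]; last by exists i.
by exists i => //=; rewrite mem_index_enum.
Qed.

Lemma some_win_measurable : measurable some_win.
Proof.
by rewrite some_winE; apply: bigsetU_measurable => i _;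
  exact: win_event_measurable.
Qed.

Lemma win_event_trivIset : trivIset setT win_event.
Proof.
apply/trivIsetP => i j _ _ ij; apply/seteqP; split=> // w.
move=> [/winsE[_ hi] /winsE[_ hj]].
by have := lt_trans (hi _ (contra_neq esym ij)) (hj _ ij); rewrite ltxx.
Qed.

Lemma pr_some_win_sum : pr P some_win = \sum_i pr P (win_event i).
Proof.
have mW := win_event_measurable.
apply: EFin_inj; rewrite -prE; last exact: some_win_measurable.
rewrite some_winE measure_bigsetU_ord//; last exact: win_event_trivIset.
rewrite -sumEFin; apply: eq_bigr => i _.
by rewrite -[LHS]/(P (win_event i)) prE.
Qed.

(** Off the null events of a negative score ([N1]) and of a positive tie ([N2]), either all scores
    are 0 or the player with the maximal score is positive and strictly ahead, hence wins. *)
Lemma pr_some_win : pr P some_win = 1 - \prod_i bust (kappa i).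
Proof.
have mW := some_win_measurable; have m0 := all_zero_measurable.
rewrite -pr_all_zero; apply/eqP; rewrite eq_sym subr_eq eq_sym; apply/eqP.
rewrite -prU//; last first.
  apply/seteqP; split=> // w [[i /winsE[h _]] /(_ i) h0].
  by rewrite h0 ltxx in h.
apply/le_anti; rewrite pr_le1/=; last exact: measurableU.
pose N1 := \big[setU/set0]_(i <- index_enum 'I_n) [set w | X i w < 0].
pose N2 := \big[setU/set0]_(p <- index_enum ('I_n * 'I_n)%type)
  (if p.1 == p.2 then set0 else tie_event p.1 p.2).
have mN1 : measurable N1.
  by apply: bigsetU_measurable => i _; exact: measurable_lt.
have mtie (p : 'I_n * 'I_n) :
    measurable (if p.1 == p.2 then set0 else tie_event p.1 p.2).
  by case: ifP => // _; exact: tie_event_measurable.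
have mN2 : measurable N2 by exact: bigsetU_measurable.
have prN1 : pr P N1 = 0.
  apply: pr_bigsetU0 => i; first exact: measurable_lt.
  by have [] := lawX i.
have prN2 : pr P N2 = 0.
  apply: pr_bigsetU0 => // p; case: ifPn => [_|]; first by rewrite pr_set0.
  exact: pr_tie.
rewrite -(pr_setT P) -[leRHS]addr0 -[X in _ <= _ + X](addr0 0).
rewrite -[X in _ <= _ + (X + _)]prN1 -[X in _ <= _ + (_ + X)]prN2.
apply: (@le_trans _ _ (pr P (some_win `|` all_zero) + pr P (N1 `|` N2)));
  last first.
  by rewrite lerD2l; apply: pr_leU => //; exact: measurableU.
apply: pr_leU; [exact: measurableU|exact: measurableU|by []|].
move=> w _.
have [w1|w1] := pselect (N1 w); first by right; left.
have [w2|w2] := pselect (N2 w); first by right; right.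
have [w0|/existsNP[i0 /eqP Xi0]] := pselect (all_zero w); first by left; right.
left; left.
have ge0 i : 0 <= X i w.
  rewrite leNgt; apply/negP => Xi; apply: w1; rewrite /N1 -bigcup_seq.
  by exists i => //=; rewrite mem_index_enum.
pose k := [arg max_(i > i0) X i w]%O.
have kmax i : X i w <= X k w by rewrite /k; case: arg_maxP => // j _; exact.
have k0 : 0 < X k w by rewrite (lt_le_trans _ (kmax i0))// lt_neqAle eq_sym Xi0
  ge0.
exists k; apply/winsE; split=> // j jk; rewrite lt_neqAle kmax andbT.
apply/eqP => Xjk; apply: w2; rewrite /N2 -bigcup_seq.
exists (k, j); first by rewrite /= mem_index_enum.
by rewrite /= eq_sym (negbTE jk).
Qed.


(** With [c = 1 / (n - 1)], the payoff is as if everybody paid [c] whenever there is a winner, who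
    then receives [1 + c]: a combination of two indicators. *)
Lemma expected_payoffE i :
  'E_P[fun w => payoff (fun j => X j w) i]%E =
  ((1 + (n%:R - 1)^-1) * pr P (win_event i) - (n%:R - 1)^-1 * pr P some_win)%:E.
Proof.
have mW := win_event_measurable; have mS := some_win_measurable.
set c := (n%:R - 1)^-1.
have indicL (A : set T) : measurable A -> (\1_A : T -> R) \in Lfun P 1.
  by move=> mA; apply/Lfun1_integrable; exact: integrable_indic.
rewrite (_ : (fun w => _) =
    ((1 + c) \o* \1_(win_event i)) \- (c \o* \1_some_win)); last first.
  apply/funext => w /=; rewrite /payoff !indicE.
  have [wi|nwi] := ifPn.
    by rewrite !mem_set /=; [ring|exists i|].
  rewrite (memNset (A := win_event i)) /=; last exact/negP.
  case: ifPn => [/existsP[j wj]|/existsPn nw].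
    by rewrite mem_set /=; [rewrite /c; ring|exists j].
  by rewrite memNset /=; [ring|case=> j; exact/negP].
rewrite expectationB ?Lfun_scale ?indicL//.
by rewrite !expectationZl ?indicL// !expectation_indic// !prE.
Qed.

End Profile.

(** * One player deviating from a common threshold *)

Section Deviation.
Set Implicit Arguments.
Unset Strict Implicit.
Context {R : realType} {d : measure_display} {T : measurableType d}.
Variables (P : probability T R) (n : nat) (X : 'I_n -> {RV P >-> R}).
Variables (i : 'I_n) (g t : R).
Hypothesis g01 : 0 < g < 1.
Hypothesis t01 : 0 <= t <= 1.
Hypothesis lawXi : score_law (X i) t.
Hypothesis lawX : forall j, j != i -> score_law (X j) g.
Hypothesis indepX : mutually_independent X.

(** Beyond [c] the deviator and his opponents all have their constant densities [expR t] and
    [expR g]. *)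
Let c := Num.max t g.
Let u := 1 - expR g * (1 - c).

Lemma pr_dominates (A : set R) y : measurable A -> c <= y -> y <= 1 ->
  pr P [set w | A (X i w) /\ forall j, j != i -> X j w < y] =
  pr P (X i @^-1` A) * (1 - expR g * (1 - y)) ^+ n.-1.
Proof.
move=> mA cy y1; have /andP[g0 g1] := g01.
have gy : g <= y by rewrite (le_trans _ cy)// le_max lexx orbT.
pose B j := if j == i then A else [set x | x < y].
have mB j : measurable (B j).
  by rewrite /B; case: ifP => // _; apply: measurable_lt; exact: measurable_id.
have := pr_indep indepX (index_enum_uniq _) mB.
rewrite (_ : \bigcap_(j in _) _ =
    [set w | A (X i w) /\ forall j, j != i -> X j w < y]); last first.
  apply/seteqP; split=> w /= h; last first.
    by move=> j _; rewrite /B/=; case: eqVneq => [->|/(proj2 h)//]; case: h.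
  split; first by have := h i (mem_index_enum _); rewrite /B/= eqxx.
  by move=> j ji; have := h j (mem_index_enum _); rewrite /B/= (negbTE ji).
move=> ->; rewrite (bigD1 i)//= {1}/B eqxx; congr (_ * _).
rewrite (eq_bigr (fun=> 1 - expR g * (1 - y))); last first.
  move=> j ji; rewrite /B (negbTE ji); have [_ _ cdfX] := lawX ji.
  rewrite -[LHS]/(pr P [set w | X j w < y]) cdfX ?y1 ?(lt_le_trans g0)//.
  by rewrite /score_cdf (max_idPl gy).
by rewrite prodr_const (@eq_card _ _ (predC1 i))// cardC1 card_ord.
Qed.

(** The Riemann form of the integral of [expR t * F y ^+ n.-1] over [[c, 1]], where
    [F y = 1 - expR g * (1 - y)] is the distribution function of an opponent. As [F' = expR g], a
    primitive is [expR (t - g) * F y ^+ n / n]; moreover [F 1 = 1] and [F c = u]. *)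
Lemma pr_win_deviation_above :
  pr P (win_event X i `&` [set w | c <= X i w < 1]) <=
  expR (t - g) * ((1 - u ^+ n) / n%:R).
Proof.
have /andP[g0 g1] := g01; have /andP[t0 t1] := t01.
have gc : g <= c by rewrite le_max lexx orbT.
have tc : t <= c by rewrite le_max lexx.
have c0 : 0 < c by exact: lt_le_trans gc.
have c1 : c <= 1 by rewrite ge_max t1 ltW.
have n0 : (0 < n)%N by exact: leq_ltn_trans (ltn_ord i).
have nR0 : 0 < n%:R :> R by rewrite ltr0n.
apply: (@le_of_le_add_inv _ (expR t)) => m m0.
have mR0 : 0 < m%:R :> R by rewrite ltr0n.
set e := (1 - c) / m%:R; have e0 : 0 <= e by rewrite divr_ge0 ?subr_ge0 ?(ltW
  mR0).
pose z l : R := c + l%:R * e.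
have zS l : z l.+1 = z l + e by rewrite /z -natr1; ring.
have z_homo : {homo z : i j / (i <= j)%N >-> i <= j}.
  by move=> a b ab; rewrite lerD2l ler_wpM2r// ler_nat.
have z0 : z 0%N = c by rewrite /z mul0r addr0.
have zm : z m = 1 by rewrite /z /e [_ * (_ / _)]mulrC divfK ?gt_eqF// subrKC.
pose F (x : R) : R := 1 - expR g * (1 - x).
have Fz_ge0 l : 0 <= F (z l).
  have cz : c <= z l by rewrite -z0 z_homo.
  apply: (le_trans (bust_ge0 (x := g) _)); first by rewrite !ltW.
  by rewrite lerD2l lerN2 ler_pM2l ?expR_gt0// lerD2l lerN2 (le_trans gc).
have FS l : F (z l.+1) - F (z l) = expR g * e by rewrite /F zS; ring.
have Fz_mono l : F (z l) <= F (z l.+1).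
  by rewrite -subr_ge0 FS mulr_ge0 ?expR_ge0.
have mX : measurable_fun setT (X i) by [].
have mW := win_event_measurable X i.
have grid := @pr_grid _ _ _ P (X i) _ z m mX mW z_homo.
pose gr l := pr P (win_event X i `&` [set w | z l <= X i w < z l.+1]).
(* The second summand is the primitive; the first absorbs the gap between upper and lower Riemann
   terms and costs at most [expR t / m] in total. *)
pose G l := - (expR t * e * F (z l) ^+ n.-1 + expR (t - g) * (F (z l) ^+ n /
  n%:R)).
rewrite -{1}z0 -zm grid; apply: (@le_trans _ _ (G 0%N - G m)); last first.
  rewrite /G z0 zm (_ : F 1 = 1); last by rewrite /F; ring.
  rewrite -/(F c) !expr1n -[u]/(F c).
  have : 0 <= F c ^+ n.-1 by rewrite exprn_ge0// -z0.
  have : expR t * e <= expR t / m%:R.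
    by rewrite ler_pM2l ?expR_gt0// /e -[leRHS]mul1r ler_pM2r ?invr_gt0//; lra.
  have : 0 <= expR t * e by rewrite mulr_ge0 ?expR_ge0.
  move=> h1 h2 h3; have := mulr_ge0 h1 h3.
  by rewrite mulrBl mulrBr; lra.
apply: (@sum_le_telescope _ m gr G) => l lm.
have cz : c <= z l by rewrite -z0 z_homo.
have zl0 : 0 < z l by rewrite (lt_le_trans c0).
have zl1 : z l.+1 <= 1 by rewrite -zm z_homo.
have zz : z l <= z l.+1 by exact: z_homo.
(* Winning with a score in cell [l] forces every opponent below its upper end [z l.+1]. *)
apply: (@le_trans _ _ (expR t * e * F (z l.+1) ^+ n.-1)).
  have -> : expR t * e = pr P (X i @^-1` [set x | z l <= x < z l.+1]).
    rewrite -[RHS]/(pr P [set w | z l <= X i w < z l.+1]).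
    rewrite (score_law_co lawXi)// (max_idPl _) ?(max_idPl _) ?(le_trans tc)//.
      by rewrite zS; ring.
    by rewrite (le_trans cz).
  have mco : measurable [set x : R | z l <= x < z l.+1].
    by apply: measurable_co; exact: measurable_id.
  rewrite -pr_dominates ?(le_trans cz)//; apply: pr_mono.
  - by apply: measurableI => //; exact: measurable_co.
  - rewrite (_ : [set w | _] = X i @^-1` [set x | z l <= x < z l.+1] `&`
      [set w | forall j, (if j == i then setT else [set w | X j w < z l.+1])
        w]).
      apply: measurableI; first exact: measurable_co.
      by apply: measurable_forall => j; case: ifP => // _; exact: measurable_lt.
    apply/seteqP; split=> w [h1 h2]; split=> // j;
      first by case: ifPn => // /h2.
    by move=> ji; have := h2 j; rewrite (negbTE ji).
  - move=> w [/winsE[_ hj] /= /andP[h1 h2]]; split; first by rewrite /= h1.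
    by move=> j ji; exact: lt_trans (hj _ ji) h2.
have tang : n%:R * (F (z l) ^+ n.-1 * (expR g * e)) <= F (z l.+1) ^+ n - F (z
  l) ^+ n.
  by rewrite -(FS l) lerBrDl expr_tangent_le// Fz_ge0 Fz_mono.
have step : expR t * e * F (z l) ^+ n.-1 <=
    expR (t - g) * ((F (z l.+1) ^+ n - F (z l) ^+ n) / n%:R).
  rewrite (_ : expR t = expR (t - g) * expR g); last by rewrite -expRD subrK.
  rewrite -2!mulrA ler_pM2l ?expR_gt0// ler_pdivlMr//.
  by apply: le_trans tang; rewrite le_eqVlt; apply/orP; left; apply/eqP; ring.
by move: step; rewrite /G mulrBl mulrBr; lra.
Qed.

(* A win with a score below [c] forces all the opponents below [c], which gives
   the first summand. *)
Lemma deviation_wins_le : pr P (win_event X i) <=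
  expR t * (c - t) * u ^+ n.-1 + expR (t - g) * ((1 - u ^+ n) / n%:R).
Proof.
have /andP[g0 g1] := g01; have /andP[t0 t1] := t01.
have gc : g <= c by rewrite le_max lexx orbT.
have tc : t <= c by rewrite le_max lexx.
have c0 : 0 < c by exact: lt_le_trans gc.
have c1 : c <= 1 by rewrite ge_max t1 ltW.
have mW := win_event_measurable X i.
have mpos : measurable [set x : R | 0 < x < c].
  rewrite (_ : [set x | _] = [set` `]0, c[]); first exact: measurable_itv.
  by apply/seteqP; split=> x /=; rewrite in_itv.
have above := pr_win_deviation_above.
have mabove : measurable (win_event X i `&` [set w | c <= X i w < 1]).
  by apply: measurableI => //; exact: measurable_co.
have mtop : measurable [set w | 1 <= X i w] by exact: measurable_ge.
set below := [set w | [set x | 0 < x < c] (X i w) /\ forall j, j != i -> X j w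
  < c].
have mbelow : measurable below.
  rewrite (_ : below = X i @^-1` [set x | 0 < x < c] `&`
      [set w | forall j, (if j == i then setT else [set w | X j w < c]) w]).
    apply: measurableI; first exact: measurable_preim.
    by apply: measurable_forall => j; case: ifP => // _; exact: measurable_lt.
  apply/seteqP; split=> w [h1 h2]; split=> // j; first by case: ifPn => // /h2.
  by move=> ji; have := h2 j; rewrite (negbTE ji).
have prbelow : pr P below <= expR t * (c - t) * u ^+ n.-1.
  rewrite pr_dominates//; apply: ler_wpM2r.
    apply: exprn_ge0; apply: (le_trans (bust_ge0 (x := g) _));
      first by rewrite !ltW.
    by rewrite lerD2l lerN2 ler_pM2l ?expR_gt0// lerD2l lerN2.
  have := score_law_gt0 lawXi (v := c); rewrite c0 c1 => /(_ isT).
  by rewrite (max_idPl tc).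
apply: (le_trans _ (lerD prbelow above)).
have mab : measurable (below `|` win_event X i `&` [set w | c <= X i w < 1]).
  exact: measurableU.
apply: (@le_trans _ _ (pr P (below `|` win_event X i `&` [set w | c <= X i w <
  1]))).
  rewrite -[leRHS]addr0 -[X in _ <= _ + X](score_law_ge1 t1 lawXi).
  apply: pr_leU => // w Ww; have /winsE[X0 hj] := Ww.
  have [X1|X1] := leP 1 (X i w); first by right.
  left; have [Xc|Xc] := leP c (X i w); first by right; split=> //=; rewrite Xc.
  by left; split=> [|j ji] /=; [rewrite X0|exact: lt_trans (hj _ ji) Xc].
by apply: pr_leU.
Qed.

End Deviation.

(** * The equilibrium *)

Section Equilibrium.
Set Implicit Arguments.
Unset Strict Implicit.
Context {R : realType} {d0 : measure_display} {T0 : measurableType d0}.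
Context {d : measure_display} {T : measurableType d}.
Variables (P0 : probability T0 R) (Z : nat -> {RV P0 >-> R}).
Variables (P : probability T R) (n : nat) (xi : 'I_n -> R -> {RV P >-> R}).
Hypothesis Zunif : forall k, uniform01 (Z k).
Hypothesis Zindep : mutually_independent Z.
Hypothesis n_gt1 : (1 < n)%N.
Hypothesis Hxi : game_scores Z xi.

Let g := gamma R n.
Let all_g (_ : 'I_n) : R := g.
Let X (j : 'I_n) : {RV P >-> R} := xi j g.

Let g01 : 0 < g < 1.
Proof. by have [[]] := gamma_spec_unique R n_gt1. Qed.

Let adm_g : admissible all_g.
Proof. by move=> i; case/andP: g01 => /ltW -> /ltW ->. Qed.

Let law_g i : score_law (X i) g.
Proof. exact: (game_scores_law Zunif Zindep Hxi i (adm_g i)). Qed.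

Let indep_g : mutually_independent X.
Proof. exact: (proj2 Hxi all_g adm_g). Qed.

Let n0 : n%:R != 0 :> R.
Proof. by rewrite pnatr_eq0 -lt0n ltnW. Qed.

Let prod_bust_g : \prod_(i < n) bust g = bust g ^+ n.
Proof. by rewrite prodr_const card_ord. Qed.

Lemma pr_all_zero_gamma : pr P (all_zero X) = bust g ^+ n.
Proof. by rewrite (pr_all_zero (kappa := all_g))// prod_bust_g. Qed.

Lemma pr_some_win_gamma : pr P (some_win X) = 1 - bust g ^+ n.
Proof. by rewrite (pr_some_win (kappa := all_g))// prod_bust_g. Qed.

(** The trivial deviation [t = g]: then [c = g], the first summand of [deviation_wins_le] vanishes
    and [u = bust g]. *)
Lemma pr_win_gamma_le i : pr P (win_event X i) <= (1 - bust g ^+ n) / n%:R.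
Proof.
have := deviation_wins_le g01 (adm_g i) (law_g i) (fun j _ => law_g j) indep_g.
by rewrite maxxx !subrr mulr0 mul0r add0r expR0 mul1r.
Qed.

Lemma pr_win_gamma i : pr P (win_event X i) = (1 - bust g ^+ n) / n%:R.
Proof.
apply/le_anti; rewrite pr_win_gamma_le/=.
set W := (1 - bust g ^+ n) / n%:R.
have : \sum_(j | j != i) pr P (win_event X j) <= W *+ n.-1.
  rewrite -[X in _ *+ X.-1](card_ord n) -(cardC1 i) -sumr_const.
  by apply: ler_sum => j _; exact: pr_win_gamma_le.
have : \sum_j pr P (win_event X j) = W *+ n.
  by rewrite -pr_some_win_sum// pr_some_win_gamma /W -mulr_natr divfK.
rewrite (bigD1 i)//= -[in _ *+ n](prednK (ltnW n_gt1)) mulrSr.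
lra.
Qed.

Lemma expected_payoff_gamma i : expected_payoff xi all_g i = 0%E.
Proof.
rewrite /expected_payoff (expected_payoffE X i) pr_win_gamma pr_some_win_gamma.
congr EFin; field; rewrite n0 andbT subr_eq0.
by rewrite -[1]/(1%:R) eqr_nat gtn_eqF.
Qed.

Lemma nash_equilibrium_gamma : nash_equilibrium xi all_g.
Proof.
split=> // i t t01; rewrite expected_payoff_gamma.
set kappa := deviate all_g i t.
have ki : kappa i = t by rewrite /kappa /deviate eqxx.
have kj j : j != i -> kappa j = g by rewrite /kappa /deviate => /negbTE ->.
have adm : admissible kappa.
  by move=> j; have [->|/kj ->] := eqVneq j i; [rewrite ki|exact: adm_g].
pose Y j := xi j (kappa j).
have lawY j : score_law (Y j) (kappa j).
  exact: (game_scores_law Zunif Zindep Hxi j (adm j)).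
have indepY : mutually_independent Y by exact: (proj2 Hxi kappa adm).
have lawYi : score_law (Y i) t by have := lawY i; rewrite ki.
have lawYj j : j != i -> score_law (Y j) g by move=> ji; have := lawY j;
  rewrite (kj _ ji).
have Wle := deviation_wins_le g01 t01 lawYi lawYj indepY.
rewrite /expected_payoff (expected_payoffE Y i) lee_fin.
rewrite (pr_some_win adm lawY indepY) (bigD1 i)//= ki.
rewrite (eq_bigr (fun=> bust g)) => [|j /kj -> //].
rewrite prodr_const (@eq_card _ _ (predC1 i))// cardC1 card_ord.
have := deviation_gain_le1 n_gt1 (proj1 (gamma_spec_unique R n_gt1)) t01.
rewrite /= -/g => gain.
have m0 : 0 < n%:R - 1 :> R by rewrite subr_gt0 ltr1n.
(* Multiplied by [n - 1], the payoff becomes the quantity bounded in [deviation_gain_le1], minus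
   1. *)
rewrite -(pmulr_lle0 _ m0).
rewrite (_ : _ * _ = n%:R * pr P (win_event Y i) + bust t * bust g ^+ n.-1 - 1).
  rewrite subr_le0; apply: le_trans gain; rewrite lerD2r.
  by rewrite ler_pM2l// ltr0n ltnW.
by field; rewrite gt_eqF.
Qed.

End Equilibrium.

Theorem proposition6 (R : realType)
    (d0 : measure_display) (T0 : measurableType d0) (P0 : probability T0 R)
    (Z : nat -> {RV P0 >-> R})
    (Zunif : forall k, uniform01 (Z k)) (Zindep : mutually_independent Z)
    (d : measure_display) (T : measurableType d) (P : probability T R)
    (n : nat) (n_gt1 : (1 < n)%N)
    (xi : 'I_n -> R -> {RV P >-> R}) (Hxi : game_scores Z xi) :
  let g := gamma R n in
  let all_g := fun _ : 'I_n => g in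
  unique (@gamma_spec R n) g /\
  nash_equilibrium xi all_g /\
  P [set w | forall i, xi i g w = 0] = ((1 - expR g + expR g * g) ^+ n)%:E /\
  (forall i, P [set w | wins (fun j => xi j g w) i] =
             ((1 - (1 - expR g + expR g * g) ^+ n) / n%:R)%:E) /\
  (forall i, expected_payoff xi all_g i = 0%E).
Proof.
move=> g all_g; have -> : 1 - expR g + expR g * g = bust g by rewrite /bust;
  ring.
split; first exact: gamma_spec_unique.
split; first exact: nash_equilibrium_gamma Zunif Zindep n_gt1 Hxi.
split.
  rewrite (prE P (all_zero_measurable _)).
  by rewrite (pr_all_zero_gamma Zunif Zindep n_gt1 Hxi).
split=> i; last exact: expected_payoff_gamma Zunif Zindep n_gt1 Hxi i.
rewrite (prE P (win_event_measurable _ _)).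
by rewrite (pr_win_gamma Zunif Zindep n_gt1 Hxi).
Qed.
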